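(* There is an absolute constant $C>0$ such that the following holds. Let $F$ be a field of odd positive characteristic $p$, let $A,B\subset F_*=F\setminus\{0\}$ be finite sets with $|A|,|B|>1$ and $|B|\le|A|<p^{2/3}$, let $P=A\times B\subset F^2$ and $n=|P|=|A||B|$. Then the number of collinear triples of points of $P$ is at most $$C\,(n^{9/4}+|A|^3|B|),$$ and for every $m\ge1$ and every set $\mathcal{M}$ of $m$ lines in $F^2$, $$|\{(q,l)\in P\times\mathcal{M}: q\in l\}|\ \le\ C\,(n^{3/4}m^{2/3}+m+n).$$
   Context: The number of collinear triples of points of $P$ is the number of ordered triples $(q_1,q_2,q_3)\in P^3$ (points not necessarily distinct) lying on a common line of $F^2$. *)

(* Defs.v *)
From HB Require Import structures.
From mathcomp Require Import all_boot all_order all_algebra.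
From mathcomp Require Import finmap.
From mathcomp Require Import boolp classical_sets reals exp.

Set Implicit Arguments.
Unset Strict Implicit.
Unset Printing Implicit Defensive.

Import Order.TTheory GRing.Theory Num.Theory.

Local Open Scope fset_scope.
Local Open Scope ring_scope.

Definition is_line (F : fieldType) (l : set (F * F)) : Prop :=
  exists a b c : F,
    (a, b) != (0, 0) /\ l = [set q | a * q.1 + b * q.2 = c]%classic.

Definition collinear (F : fieldType) (q1 q2 q3 : F * F) : Prop :=
  exists l : set (F * F), [/\ is_line l, l q1, l q2 & l q3].

(* Ordered triples, with repetitions allowed. *)
Definition collinear_triples (F : fieldType) (P : {fset F * F}) :
    {fset F * F * (F * F) * (F * F)} :=
  [fset t in P `*` P `*` P | `[< collinear t.1.1 t.1.2 t.2 >]].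

Definition incidences (F : fieldType) (P : {fset F * F})
    (M : {fset set (F * F)}) : {fset F * F * set (F * F)} :=
  [fset ql in P `*` M | `[< ql.2 ql.1 >]].

(* Main.v *)
(* Nondegenerate collinear triples of A x A are the zeros of
   b(a1 - a2) + c(b2 - b1) + a2 b1 - a1 b2, an incidence relation between |A|^3
   points (a1, a2, b) and |A|^3 planes (b1, b2, c) of projective 3-space.  A
   hyperplane section of the Klein quadric turns both into lines of affine
   3-space with isotropic directions (k^2, -k, 1), incidence becoming
   intersection; over F(X) the section can be chosen so that lines of the same
   family are skew.  If there were more than C |A|^{9/2} incidences, a
   subconfiguration would have large minimum degree, and counting parameters
   along a random order of its lines gives a polynomial of degree d, small
   against the square root of the number of lines and d < p/2, vanishing on all
   of them.  Some prime factor g still contains many lines.  At a general point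
   of such a line the surface g = 0 contains lines in both isotropic tangent
   directions, so its second fundamental form vanishes on them; by Bezout this
   holds on the whole surface, which is thus umbilic.  Along a line this is an
   ordinary differential equation which, the degrees being less than p/2, forces
   the second direction to be a Moebius function of the parameter, hence to take
   more values than the |A| available ones.

   For A x B one applies the Cauchy-Schwarz inequality to the sum over the
   common ratio (a3 - a1)/(a2 - a1) = (b3 - b1)/(b2 - b1), and the incidence
   bound follows by comparing the number of points k of an oblique line with its
   k^2 (k - 1) triples. *)
Require Import Defs.
From HB Require Import structures.
From mathcomp Require Import all_boot all_order all_algebra fingroup perm.
From mathcomp Require Import ring lra zify.
From mathcomp Require mpoly finmap boolp classical_sets reals exp.

Set Implicit Arguments.
Unset Strict Implicit.
Unset Printing Implicit Defensive.

Import Order.TTheory GRing.Theory Num.Theory.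

Local Open Scope ring_scope.

(** * Factoriality of polynomial rings *)

Definition divides (R : idomainType) (a b : R) := exists c, b = a * c.

Definition prime_elt (R : idomainType) (p : R) :=
  [/\ p != 0, p \isn't a GRing.unit &
      forall a b, divides p (a * b) -> divides p a \/ divides p b].

(** Asking for prime rather than irreducible factors makes the factorisation unique up to units and
    order without a separate clause. *)
Definition factorial_domain (R : idomainType) :=
  forall x : R, x != 0 -> exists s : seq R, exists2 u,
    u \is a GRing.unit & (forall p, p \in s -> prime_elt p) /\
                         x = u * \prod_(p <- s) p.

Section Gauss.
Variable R : idomainType.
Implicit Types (p c : R) (f g : {poly R}).

Lemma divides_polyC p f :
  divides p%:P f <-> forall i, divides p f`_i.
Proof.
split=> [[g ->] i|]; first by exists g`_i; rewrite mul_polyC coefZ.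
move=> pf; have [g gP] := boolp.choice pf.
exists (\poly_(i < size f) g i); apply/polyP=> i.
rewrite mul_polyC coefZ coef_poly; case: ltnP => [_|le]; first exact: gP.
by rewrite mulr0 nth_default.
Qed.

(** Gauss's lemma by descent: [p] divides the product of the leading coefficients, hence one of
    them, and removing that leading term lowers the total size while the product stays divisible. *)
Lemma prime_elt_polyC p : prime_elt p -> prime_elt p%:P.
Proof.
move=> [p0 pU pP]; split; first by rewrite polyC_eq0.
  by apply: contra pU; rewrite poly_unitE coefC eqxx => /andP[].
suff main n f g : (size f + size g < n)%N -> divides p%:P (f * g) ->
    divides p%:P f \/ divides p%:P g by move=> f g; apply: main (ltnSn _).
elim: n f g => // n IHn f g lt_n pfg.
have [->|f0] := eqVneq f 0; first by left; exists 0; rewrite mulr0.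
have [->|g0] := eqVneq g 0; first by right; exists 0; rewrite mulr0.
have red (h : {poly R}) : h != 0 -> divides p (lead_coef h) ->
    exists (h1 : {poly R}) (c : R), h = p%:P * (c *: 'X^((size h).-1)) + h1 /\ (size h1 < size h)%N.
  move=> h0 [c hc]; pose m : {poly R} := c *: 'X^((size h).-1).
  exists (h - p%:P * m), c; rewrite addrC subrK; split=> //.
  have sh : (0 < size h)%N by rewrite size_poly_gt0.
  rewrite -[X in (_ < X)%N](prednK sh) ltnS; apply/leq_sizeP => j lej.
  rewrite coefB mul_polyC !coefZ coefXn.
  have [<-|nej] := eqVneq (size h).-1 j.
    by rewrite mulr1 -hc lead_coefE subrr.
  rewrite !mulr0 subr0 nth_default //.
  by rewrite -(prednK sh) ltn_neqAle nej.
have : divides p (lead_coef f * lead_coef g).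
  by have /divides_polyC pfg' := pfg; rewrite -lead_coefM lead_coefE; apply: pfg'.
case/pP=> [/(red _ f0)|/(red _ g0)] [h [c [eh lth]]].
- have dv : divides p%:P (h * g).
    have -> : h = f - p%:P * (c *: 'X^((size f).-1)).
      by rewrite [X in X - _]eh addrC addKr.
    case: pfg => q eq; exists (q - c *: 'X^((size f).-1) * g).
    by rewrite mulrBl eq mulrBr mulrA.
  have [|[q hq]|] := IHn h g _ dv; last by right.
    by rewrite -ltnS (leq_trans _ lt_n) // ltnS ltn_add2r.
  by left; exists (c *: 'X^((size f).-1) + q); rewrite {1}eh hq mulrDr.
- have dv : divides p%:P (f * h).
    have -> : h = g - p%:P * (c *: 'X^((size g).-1)).
      by rewrite [X in X - _]eh addrC addKr.
    case: pfg => q eq; exists (q - f * (c *: 'X^((size g).-1))).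
    by rewrite mulrBr eq mulrBr (mulrCA f).
  have [|?|[q hq]] := IHn f h _ dv; last 1 first.
  - by right; exists (c *: 'X^((size g).-1) + q); rewrite {1}eh hq mulrDr.
  - by rewrite -ltnS (leq_trans _ lt_n) // ltnS ltn_add2l.
  by left.
Qed.

Definition primitive f := forall p, prime_elt p -> ~ divides p%:P f.

(** The primes of [c] are cancelled one at a time: each divides [g * h] but not [g], hence divides
    [h]. *)
Lemma primitive_cancel (HR : factorial_domain R) g f h c :
  primitive g -> c != 0 -> c%:P * f = g * h -> divides g f.
Proof.
move=> gprim /HR[s [u uU [sP ->]]].
elim: s sP f h => [_|p s IHs sP] f h.
  rewrite big_nil mulr1 => eq; exists (u^-1%:P * h).
  by rewrite mulrCA -eq mulrA -polyCM mulVr // mul1r.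
have pP : prime_elt p by apply: sP; rewrite mem_head.
rewrite big_cons mulrCA polyCM -mulrA => eq.
have [p0 _ pM] := prime_elt_polyC pP.
have /pM[/gprim|[q hq]] : divides p%:P (g * h) by rewrite -eq; exists ((u * \prod_(j <- s) j)%:P * f).
  by move/(_ pP).
apply: (IHs _ _ q) => [x xs|]; first by apply: sP; rewrite inE xs orbT.
by apply: (mulfI p0); rewrite eq hq mulrCA.
Qed.

(** Induction on the number of primes in the leading coefficient: a prime constant dividing [f] is
    associated with one of them, and the quotient has one fewer. *)
Lemma content_decomposition (HR : factorial_domain R) f :
  f != 0 -> exists c f1, [/\ c != 0, f = c%:P * f1 & primitive f1].
Proof.
move=> f0; have /HR[s [u uU []]] : lead_coef f != 0 by rewrite lead_coef_eq0.
move: {2}(size s) (erefl (size s)) => n.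
elim: n s u uU f f0 => [|n IHn] s u uU f f0 sz sP lf.
  exists 1, f; rewrite oner_eq0 mul1r; split=> // p [p0 pU _].
  move/divides_polyC/(_ (size f).-1); rewrite -lead_coefE lf.
  rewrite (size0nil sz) big_nil mulr1 => -[c uc].
  by move: uU; rewrite uc unitrM (negPf pU).
case: (boolp.EM (primitive f)) => [fP|].
  by exists 1, f; rewrite oner_eq0 mul1r.
move=> /boolp.existsNP[p] /boolp.not_implyP[pP /boolp.contrapT[f1 ef]].
have [p0 pU pM] := pP.
have f10 : f1 != 0 by apply: contraNneq f0 => f10; rewrite ef f10 mulr0.
have [q qs [d qd]] : exists2 q, q \in s & divides p q.
  have : divides p (u * \prod_(j <- s) j).
    by rewrite -lf ef lead_coefM lead_coefC; exists (lead_coef f1).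
  case/pM=> [[c uc]|].
    by move: uU; rewrite uc unitrM (negPf pU).
  elim: (s) => [|x t IHt].
    by rewrite big_nil => -[c uc]; move: (unitr1 R); rewrite uc unitrM (negPf pU).
  rewrite big_cons => /pM[px|/IHt[q qt pq]]; first by exists x; rewrite ?mem_head.
  by exists q => //; rewrite inE qt orbT.
have [q0 qU qM] := sP q qs.
have dU : d \is a GRing.unit.
  have : divides q (p * d) by exists 1; rewrite mulr1.
  case/qM=> -[e eq].
    apply/unitrPr; exists e; apply: (mulfI p0).
    by rewrite mulr1 mulrA -qd -eq.
  have : p * e = 1 by apply: (mulIf q0); rewrite mul1r [RHS]qd eq -mulrA (mulrC e).
  by move=> pe; move: (unitr1 R); rewrite -pe unitrM (negPf pU).
have [||||c [f2 [c0 ef1 f2P]]] := IHn (rem q s) (u * d) _ f1 f10.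
- by rewrite unitrM uU.
- by rewrite size_rem // sz.
- by move=> x /mem_rem; apply: sP.
- apply: (mulfI p0); have := lf; rewrite ef lead_coefM lead_coefC => ->.
  by rewrite (perm_big _ (perm_to_rem qs)) big_cons qd /=; ring.
exists (p * c), f2; split=> //; first by rewrite mulf_neq0.
by rewrite ef ef1 polyCM mulrA.
Qed.

(** The last hypothesis is irreducibility over the fraction field with denominators cleared. The
    relation [%|] only gives divisibility up to a constant of [R], which [primitive_cancel]
    removes. *)
Lemma prime_elt_primitive (HR : factorial_domain R) g :
  primitive g -> (1 < size g)%N ->
  (forall a b c, c != 0 -> c%:P * g = a * b -> (size a <= 1)%N \/ (size b <= 1)%N) ->
  prime_elt g.
Proof.
move=> gP sg girr; have g0 : g != 0 by rewrite -size_poly_gt0 ltnW.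
split=> // [|a b [q ab]].
  by rewrite poly_unitE; apply/nandP; left; rewrite gtn_eqF.
have [[c h] /= c0] := Pdiv.WeakIdomain.dvdpP _ _ (dvdp_gcdl g a).
(* Either the cofactor [h] is constant and [g] divides [a], or the gcd is constant and [g] divides
   [b]. *)
rewrite -mul_polyC => eg; have [sh|sd] := girr _ _ _ c0 eg.
  have h0 : h != 0.
    apply: contraTneq g0 => h0; have := eg; rewrite h0 mul0r => /eqP.
    by rewrite mulf_eq0 polyC_eq0 (negPf c0) /= => ->.
  have sh1 : size h = 1%N by apply/eqP; rewrite eqn_leq sh size_poly_gt0.
  have [[c' k] /= c'0] := Pdiv.WeakIdomain.dvdpP _ _ (dvdp_gcdr g a).
  rewrite -mul_polyC => ea; left.
  have [d d0 hd] : exists2 d, d != 0 & h = d%:P.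
    by apply/size_poly1P; rewrite sh1.
  apply: (@primitive_cancel HR _ _ (c%:P * k) (d * c')) => //.
    by rewrite mulf_neq0.
  by rewrite polyCM -mulrA ea -hd mulrCA -eg; ring.
have cop : coprimep g a.
  by rewrite coprimep_def eqn_leq sd size_poly_gt0 gcdp_eq0 negb_and g0.
have : g %| b by rewrite -(Gauss_dvdpr _ cop) ab dvdp_mulr.
case/Pdiv.WeakIdomain.dvdpP => -[c' k] /= c'0; rewrite -mul_polyC => eb.
by right; apply: (@primitive_cancel HR _ _ k c') => //; rewrite eb mulrC.
Qed.

Lemma factorial_poly (HR : factorial_domain R) : factorial_domain {poly R}.
Proof.
move=> f; move: {2}(size f).+1 (ltnSn (size f)) => n.
elim: n f => // n IHn f; rewrite ltnS => szf f0.
have [c [f1 [c0 ef f1P]]] := content_decomposition HR f0.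
have [s [u uU [sP cE]]] := HR _ c0.
have f10 : f1 != 0 by apply: contraNneq f0 => f10; rewrite ef f10 mulr0.
have sf1 : size f1 = size f by rewrite ef mul_polyC size_scale.
suff [s' [u' u'U [s'P f1E]]] : exists s : seq {poly R}, exists2 u,
    u \is a GRing.unit & (forall p : {poly R}, p \in s -> prime_elt p) /\
                         f1 = u * \prod_(p <- s) p.
  exists ([seq x%:P | x <- s] ++ s'), (u%:P * u').
    by rewrite unitrM u'U rmorph_unit.
  split=> [x|].
    by rewrite mem_cat => /orP[/mapP[y /sP yP ->]|/s'P//]; apply: prime_elt_polyC.
  by rewrite ef cE f1E big_cat big_map /= polyCM rmorph_prod mulrACA.
(* A primitive constant is a unit, since a prime factor of it would divide [f1]. *)
have [sz1|sz1] := leqP (size f1) 1.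
  exists [::], f1; last by rewrite big_nil mulr1.
  have [d d0 ed] : exists2 d, d != 0 & f1 = d%:P.
    by apply/size_poly1P; rewrite eqn_leq sz1 size_poly_gt0.
  have [[|p t] [v vU [tP dE]]] := HR _ d0.
    by rewrite ed dE big_nil mulr1 rmorph_unit.
  case: (f1P p); first by apply: tP; rewrite mem_head.
  by exists (v * \prod_(j <- t) j)%:P; rewrite ed dE big_cons -polyCM mulrCA.
case: (boolp.EM (forall a b c, c != 0 -> c%:P * f1 = a * b ->
    (size a <= 1)%N \/ (size b <= 1)%N)) => [irr|].
  exists [:: f1], 1; rewrite ?unitr1 // big_seq1 mul1r; split=> // p.
  by rewrite inE => /eqP->; apply: prime_elt_primitive.
(* Given a proper splitting up to a constant, the primitive part of one factor divides [f1] exactly,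
   and both pieces are smaller. *)
move=> /boolp.existsNP[a] /boolp.existsNP[b] /boolp.existsNP[d].
move=> /boolp.not_implyP[d0] /boolp.not_implyP[eab] /boolp.not_orP[].
move=> /negP; rewrite -ltnNge => sa /negP; rewrite -ltnNge => sb.
have a0 : a != 0 by rewrite -size_poly_gt0 ltnW.
have b0 : b != 0 by rewrite -size_poly_gt0 ltnW.
have [ca [a1 [ca0 ea a1P]]] := content_decomposition HR a0.
have [q f1q] : divides a1 f1.
  apply: (@primitive_cancel HR _ _ (ca%:P * b) d) => //.
  by rewrite eab ea; ring.
have sa1 : size a1 = size a by rewrite ea mul_polyC size_scale.
have [a10 q0] : a1 != 0 /\ q != 0.
  by apply/andP; rewrite -negb_or -mulf_eq0 -f1q.
have sq : size q = size b.
  have := size_mul a10 q0; have := size_mul a0 b0.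
  rewrite -eab -f1q mul_polyC size_scale // sa1 => -> .
  by case: (size a) sa => // ? _; rewrite !addSn /= => /addnI.
have szM := size_mul a0 b0; rewrite -eab mul_polyC size_scale // in szM.
have lta : (size a1 < n)%N by rewrite sa1; lia.
have ltq : (size q < n)%N by rewrite sq; lia.
have [s1 [u1 u1U [s1P e1]]] := IHn _ lta a10.
have [s2 [u2 u2U [s2P e2]]] := IHn _ ltq q0.
exists (s1 ++ s2), (u1 * u2); first by rewrite unitrM u1U.
split=> [x|]; first by rewrite mem_cat => /orP[/s1P|/s2P].
by rewrite f1q big_cat e1 e2 /= mulrACA.
Qed.
End Gauss.

Lemma factorial_iso (R S : idomainType) (phi : {rmorphism R -> S})
    (psi : {rmorphism S -> R}) :
  cancel phi psi -> cancel psi phi -> factorial_domain R -> factorial_domain S.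
Proof.
move=> phiK psiK HR x x0.
have /HR[s [u uU [sP ex]]] : psi x != 0.
  by apply: contra_neq x0 => px; rewrite -[x]psiK px rmorph0.
exists (map phi s), (phi u); first exact: rmorph_unit.
split=> [_ /mapP[p /sP[p0 pU pM] ->]|]; last first.
  by rewrite -[x]psiK ex rmorphM rmorph_prod big_map.
split.
- by apply: contra_neq p0 => pp; rewrite -[p]phiK pp rmorph0.
- by apply: contra pU => /(rmorph_unit psi); rewrite phiK.
- have back a : divides p (psi a) -> divides (phi p) a.
    by case=> c pc; exists (phi c); rewrite -[a]psiK pc rmorphM.
  move=> a b [c abc]; have /pM[] : divides p (psi a * psi b).
    by exists (psi c); rewrite -rmorphM abc rmorphM phiK.
  + by move/back; left.
  + by move/back; right.
Qed.

Section MPolyFactorial.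
Import mpoly.
Variable K : fieldType.

Let wid n (i : 'I_n) : 'I_n.+1 := widen_ord (leqnSn n) i.

(** The inverse of [muni]: the last variable replaces the indeterminate of the univariate
    polynomial. *)
Definition mmulti_morph n : {rmorphism {poly {mpoly K[n]}} -> {mpoly K[n.+1]}} :=
  (horner_eval ('X_(@ord_max n) : {mpoly K[n.+1]}) \o @mpwiden n K).

Lemma muniX n (m : 'X_{1..n.+1}) :
  muni ('X_[m] : {mpoly K[n.+1]}) = 'X_[[multinom (m (wid i)) | i < n]] *: 'X^(m ord_max).
Proof. by rewrite muniE msuppX big_seq1 mcoeffX eqxx scale1r. Qed.

Lemma mmulti_morphC n (c : {mpoly K[n]}) : mmulti_morph n c%:P = mwiden c.
Proof. by rewrite /= /horner_eval mpwidenC hornerC. Qed.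

Lemma mmulti_morphXn n k : mmulti_morph n 'X^k = 'X_ord_max ^+ k.
Proof. by rewrite rmorphXn /= /horner_eval mpwidenX hornerX. Qed.

Lemma muniK n : cancel (@muni n K) (mmulti_morph n).
Proof.
move=> p; rewrite {2}(mpolyE p) muniE rmorph_sum; apply: eq_bigr => m _.
rewrite -mul_polyC rmorphM mmulti_morphC mmulti_morphXn mwidenZ mwidenX.
rewrite -scalerAl mpolyXn -mpolyXD; congr (_ *: 'X_[_]).
apply/mnmP => i; rewrite mnmDE mulmnE mnm1E.
have [->|ni] := eqVneq i ord_max.
  by rewrite mnmwiden_ordmax mul1n.
have lt_i : (i < n)%N.
  by rewrite ltn_neqAle -ltnS ltn_ord andbT; apply: contra ni => /eqP e; apply/eqP/val_inj.
have -> : i = wid (Ordinal lt_i) by apply: val_inj.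
by rewrite mnmwiden_widen mnmE mul0n addn0.
Qed.

Lemma mmultiK n : cancel (mmulti_morph n) (@muni n K).
Proof.
have muniwid c : muni (mwiden c) = c%:P :> {poly {mpoly K[n]}}.
  rewrite (mwidenE (leqnn (msize c))) (raddf_sum (@muni n K)) /=.
  rewrite [RHS](_ : _ = (\sum_(m : 'X_{1..n < msize c}) c@_m *: 'X_[m])%:P); last first.
    by rewrite -mpolywE.
  rewrite rmorph_sum; apply: eq_bigr => m _.
  rewrite muniZ muniX mnmwiden_ordmax expr0 -mul_polyC.
  rewrite alg_polyC -polyCM mul_mpolyC; congr (_ *: 'X_[_])%:P.
  by apply/mnmP=> i; rewrite mnmE mnmwiden_widen.
elim/poly_ind => [|q c IH]; first by rewrite !rmorph0.
rewrite (rmorphD (mmulti_morph n)) (rmorphM (mmulti_morph n)).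
rewrite muniD muniM IH mmulti_morphC muniwid.
rewrite -['X]expr1 mmulti_morphXn expr1.
congr (_ * _ + _); rewrite muniX mnm1E eqxx expr1 -[RHS]scale1r -mpolyX0.
by congr ('X_[_] *: _); apply/mnmP=> i; rewrite mnmE mnm1E mnm0E -val_eqE /= gtn_eqF.
Qed.

Lemma factorial_mpoly n : factorial_domain {mpoly K[n]}.
Proof.
elim: n => [|n IHn].
  move=> p p0; exists [::], p; last by rewrite big_nil mulr1.
  move: p0; rewrite -[p](mpolyKC) => p0; apply: rmorph_unit.
  by rewrite unitfE; apply: contra_neq p0 => ->; rewrite mpolyC0.
exact: (factorial_iso (@mmultiK n) (@muniK n)) (factorial_poly IHn).
Qed.
End MPolyFactorial.

(** * Polynomials restricted to isotropic lines *)

Lemma linear_dependence (K : fieldType) (I J : finType) (f : I -> J -> K) :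
  (#|J| < #|I|)%N ->
  exists u : I -> K, (exists i, u i != 0) /\ forall j, \sum_i u i * f i j = 0.
Proof.
move=> ltJI.
pose M : 'M[K]_(#|I|, #|J|) := \matrix_(i, j) f (enum_val i) (enum_val j).
have : kermx M != 0.
  rewrite -mxrank_eq0 mxrank_ker -lt0n subn_gt0.
  exact: leq_ltn_trans (rank_leq_col M) ltJI.
case/rowV0Pn => v /sub_kermxP vM v0.
have [i vi] : exists i, v 0 i != 0.
  by apply/existsP; apply: contraNT v0 => /existsPn v0; apply/eqP/rowP => i;
    rewrite mxE; apply/eqP; rewrite -[_ == _]negbK v0.
exists (fun i => v 0 (enum_rank i)); split; first by exists (enum_val i); rewrite enum_valK.
move=> j; have /rowP/(_ (enum_rank j)) := vM.
rewrite !mxE => sum0; rewrite -[RHS]sum0 (reindex (@enum_val I I)) /=.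
  by apply: eq_bigr => a _; rewrite !mxE enum_valK enum_rankK.
by exists enum_rank => ? _; rewrite ?enum_valK ?enum_rankK.
Qed.

Section Monomials.
Import mpoly.

(** There are C(b+2, 2) monomials of degree exactly [b], so Pascal's rule gives the induction
    step. *)
Lemma card_bounded_monomials b : #|{: 'X_{1..3 < b}}| = 'C(b.+2, 3).
Proof.
have mem_bm k (m : 'X_{1..3}) : (m \in [seq bmnm x | x <- enum {: 'X_{1..3 < k}}]) = (mdeg m < k)%N.
  apply/mapP/idP => [[x _ ->]|lt_m]; first exact: bmdeg.
  by exists (BMultinom lt_m); rewrite ?mem_enum.
have uniq_bm k : uniq [seq bmnm x | x <- enum {: 'X_{1..3 < k}}].
  by rewrite map_inj_uniq ?enum_uniq //; apply: val_inj.
rewrite cardE -(size_map (@bmnm 3 b)); elim: b => [|b IHb].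
  by apply/eqP; rewrite size_eq0; apply/eqP; case: map (mem_bm 0) => // x s /(_ x);
    rewrite mem_head.
pose r := [seq s2m (val t) | t <- enum (basis 3 b)].
have -> : size [seq bmnm x | x <- enum {: 'X_{1..3 < b.+1}}]
        = size ([seq bmnm x | x <- enum {: 'X_{1..3 < b}}] ++ r).
  apply/perm_size/uniq_perm; rewrite ?uniq_bm //.
    rewrite cat_uniq uniq_bm uniq_basis andbT /=; apply/hasPn => m.
    by rewrite -basis_cover mem_bm => /eqP->; rewrite ltnn.
  by move=> m; rewrite mem_cat !mem_bm -basis_cover ltnS leq_eqVlt orbC.
have := @bin_sub b.+2 2 isT; rewrite !subSS subn0 => b2.
by rewrite size_cat IHb size_basis addn2 b2 [RHS]binS.
Qed.

Lemma card_bounded_monomials6 b : (6 * #|{: 'X_{1..3 < b}}| = b * b.+1 * b.+2)%N.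
Proof.
have := bin_ffact b.+2 3; rewrite -card_bounded_monomials !ffactnS ffactn0 muln1 /=.
by rewrite (_ : 3`! = 6%N) // => h; lia.
Qed.

Variable K : fieldType.
Implicit Types (f g : {mpoly K[3]}) (l : K * K * K).

Definition i0 : 'I_3 := @Ordinal 3 0 isT.
Definition i1 : 'I_3 := @Ordinal 3 1 isT.
Definition i2 : 'I_3 := @Ordinal 3 2 isT.

(* The line with parameters [(k, p, q)] is the set of [x] such that
   [x_0 + k x_1 = p] and [x_1 + k x_2 = q], parametrised by [x_2]. *)
Definition line_param l : 'I_3 -> {poly K} :=
  let: (k, p, q) := l in
  fun i => if i == i0 then (p - k * q)%:P + (k ^+ 2) *: 'X
           else if i == i1 then q%:P - k *: 'X else 'X.

Definition restrict l : {mpoly K[3]} -> {poly K} := mmap (@polyC K) (line_param l).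

HB.instance Definition _ l := GRing.RMorphism.on (restrict l).

Lemma restrictX l i : restrict l 'X_i = line_param l i.
Proof. by rewrite /restrict mmapX mmap1U. Qed.

Lemma restrictC l c : restrict l c%:MP = c%:P.
Proof. exact: mmapC. Qed.

Lemma restrictZ l c f : restrict l (c *: f) = c *: restrict l f.
Proof. by rewrite /restrict mmapZ mul_polyC. Qed.

Lemma restrictD l : {morph restrict l : f g / f + g}.
Proof. exact: rmorphD. Qed.

Lemma restrictM l : {morph restrict l : f g / f * g}.
Proof. exact: rmorphM. Qed.

Lemma restrict0 l : restrict l 0 = 0.
Proof. exact: rmorph0. Qed.

Lemma size_restrict l f : (size (restrict l f) <= msize f)%N.
Proof.
rewrite /restrict /mmap; apply: leq_trans (size_sum _ _ _) _.
rewrite big_seq; apply/bigmax_leqP_seq => m mf _.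
apply: leq_trans (_ : (mdeg m).+1 <= _)%N; last first.
  by rewrite msizeE (bigD1_seq m) //= leq_maxl.
rewrite mul_polyC; apply: leq_trans (size_scale_leq _ _) _.
rewrite /mmap1 mdegE.
have szp i : (size (line_param l i) <= 2)%N.
  case: l => [[k p] q] /=.
  have sX c : (size (c *: 'X : {poly K}) <= 2)%N.
    by rewrite (leq_trans (size_scale_leq _ _)) ?size_polyX.
  have sC c : (size (c%:P : {poly K}) <= 2)%N.
    by rewrite size_polyC; case: eqP.
  case: ifP => _; first by rewrite (leq_trans (size_polyD _ _)) // geq_max sC sX.
  case: ifP => _; last by rewrite size_polyX.
  by rewrite (leq_trans (size_polyD _ _)) // size_polyN geq_max sC sX.
apply: (big_ind2 (fun (p : {poly K}) d => (size p <= d.+1)%N)).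
- by rewrite size_poly1.
- move=> p1 d1 p2 d2 h1 h2; apply: leq_trans (size_polyMleq _ _) _; lia.
- move=> i _; apply: leq_trans (size_poly_exp_leq _ _) _.
  by rewrite ltnS -[X in (_ <= X)%N]mul1n leq_mul2r -subn1 leq_subLR szp orbT.
Qed.

Definition line_deriv k f := k ^+ 2 *: f^`M(i0) - k *: f^`M(i1) + f^`M(i2).

(** The chain rule, the line having direction (k^2, -k, 1). Both sides satisfy the product rule, so
    it suffices to check constants and variables. *)
Lemma restrict_deriv l f : (restrict l f)^`() = restrict l (line_deriv l.1.1 f).
Proof.
pose P f := (restrict l f)^`() = restrict l (line_deriv l.1.1 f).
have PD f1 f2 : P f1 -> P f2 -> P (f1 + f2).
  rewrite /P restrictD derivD => -> ->; rewrite -restrictD; congr restrict.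
  by rewrite /line_deriv !mderivD !scalerDr; ring.
have PM f1 f2 : P f1 -> P f2 -> P (f1 * f2).
  rewrite /P restrictM derivM => -> ->; rewrite -!restrictM -restrictD; congr restrict.
  by rewrite /line_deriv !mderivM -!mul_mpolyC; ring.
have PC c : P c%:MP.
  by rewrite /P restrictC derivC /line_deriv !mderivC !scaler0 subr0 addr0 restrict0.
have P1 : P 1 by exact: (PC 1).
have PX i : P 'X_i.
  have dX j : ('X_i : {mpoly K[3]})^`M(j) = (i == j)%:R%:MP.
    rewrite mderivX mnm1E; have [->|_] := eqVneq i j; last by rewrite scale0r mpolyC0.
    by rewrite scale1r -{1}[U_(j)%MM]add0m addmK mpolyX0 mpolyC1.
  rewrite /P restrictX /line_deriv !dX -!mul_mpolyC -!mpolyCM -mpolyCB -mpolyCD restrictC.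
  case: (l) => [[k p] q] /=; case: i {dX} => [[|[|[|//]]]] h; rewrite -!val_eqE /=.
  - by rewrite derivD derivC derivZ derivX !mulr0 mulr1 subr0 addr0 add0r -mul_polyC mulr1.
  - by rewrite derivB derivC derivZ derivX !mulr0 mulr1 !sub0r addr0 -mul_polyC mulr1 polyCN.
  - by rewrite derivX !mulr0 subr0 add0r.
suff: P f by [].
rewrite (mpolyE f); apply: (big_ind P); [|exact: PD|move=> m _].
  by rewrite -(mpolyC0 3); apply: PC.
rewrite -mul_mpolyC; apply: (PM); first exact: PC.
rewrite mpolyXE_id; apply: (big_ind P); [by []|exact: PM|move=> i _].
by elim: (m i) => [|d IHd]; rewrite ?expr0 // exprS; apply: PM.
Qed.
End Monomials.

(** * A Bezout bound for lines on a prime surface *)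

Section Bezout.
Import mpoly.
Variable K : fieldType.
Implicit Types (f g : {mpoly K[3]}) (l : K * K * K).

Definition plane1 l : {mpoly K[3]} := 'X_i0 + l.1.1 *: 'X_i1 - l.1.2%:MP.
Definition plane2 l : {mpoly K[3]} := 'X_i1 + l.1.1 *: 'X_i2 - l.2%:MP.

Lemma restrict_plane1 l l' : restrict l (plane1 l') =
  (l.1.2 - l'.1.2 + (l'.1.1 - l.1.1) * l.2)%:P + (l.1.1 * (l.1.1 - l'.1.1)) *: 'X.
Proof.
rewrite /plane1 restrictD -mpolyCN restrictC restrictD restrictZ !restrictX.
case: l l' => [[k p] q] [[k' p'] q'] /=.
by rewrite -!mul_polyC !(polyCD, polyCM, polyCN) ; ring.
Qed.

Lemma restrict_plane2 l l' : restrict l (plane2 l') =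
  (l.2 - l'.2)%:P + (l'.1.1 - l.1.1) *: 'X.
Proof.
rewrite /plane2 restrictD -mpolyCN restrictC restrictD restrictZ !restrictX.
case: l l' => [[k p] q] [[k' p'] q'] /=.
by rewrite -!mul_polyC !(polyCD, polyCM, polyCN) ; ring.
Qed.

Lemma poly_affine_eq0 (a b : K) : (a%:P + b *: 'X == 0) = (a == 0) && (b == 0).
Proof.
apply/eqP/andP => [/polyP ab0|[/eqP-> /eqP->]]; last by rewrite scale0r addr0.
have := ab0 0%N; have := ab0 1%N; rewrite !coefD !coefZ !coefC !coefX /=.
by rewrite mulr1 mulr0 addr0 add0r => -> ->.
Qed.

(** If both planes defining [l'] contained [l], the three parameters would agree. *)
Lemma separating_plane l l' : l != l' -> exists f,
  [/\ (msize f <= 2)%N, restrict l' f = 0 & restrict l f != 0].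
Proof.
have sX i : (msize ('X_i : {mpoly K[3]}) <= 2)%N by rewrite msizeX mdeg1.
have sC c : (msize (c%:MP : {mpoly K[3]}) <= 2)%N by rewrite msizeC; case: eqP.
have sP a b i j : (msize ('X_i + a *: 'X_j - b%:MP : {mpoly K[3]}) <= 2)%N.
  rewrite (leq_trans (msizeD_le _ _)) // geq_max msizeN sC andbT.
  by rewrite (leq_trans (msizeD_le _ _)) // geq_max sX (leq_trans (msizeZ_le _ _)).
move=> nll'; have [r1|r1] := eqVneq (restrict l (plane1 l')) 0; last first.
  exists (plane1 l'); split; [exact: sP| |exact: r1]; apply/eqP.
  by rewrite restrict_plane1 poly_affine_eq0 !subrr mul0r mulr0 addr0 eqxx.
exists (plane2 l'); split; first exact: sP.
  by apply/eqP; rewrite restrict_plane2 poly_affine_eq0 !subrr eqxx.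
rewrite restrict_plane2 poly_affine_eq0; apply: contra nll' => /andP[].
rewrite !subr_eq0 => /eqP e2 /eqP ek; move/eqP: r1.
rewrite restrict_plane1 poly_affine_eq0 ek subrr mul0r addr0 subr_eq0 => /andP[/eqP ep _].
by case: l l' e2 ek ep => [[? ?] ?] [[? ?] ?] /= -> -> ->.
Qed.

Lemma msize_mul_leq f g : (msize (f * g) <= (msize f + msize g).-1)%N.
Proof.
have [->|f0] := eqVneq f 0; first by rewrite mul0r msize0.
have [->|g0] := eqVneq g 0; first by rewrite mulr0 msize0.
by rewrite msizeM.
Qed.

Lemma msize_prod_le (I : Type) (r : seq I) (P : pred I) (F : I -> {mpoly K[3]}) :
  (forall i, msize (F i) <= 2)%N ->
  (msize (\prod_(i <- r | P i) F i) <= (count P r).+1)%N.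
Proof.
move=> sF; elim: r => [|i r IHr]; first by rewrite big_nil msize1.
rewrite big_cons /=; case: ifP => //= _.
apply: leq_trans (msize_mul_leq _ _) _; move: (sF i) IHr.
by move: (mmeasure _ _) (mmeasure _ _) (count _ _) => a b c; lia.
Qed.

(** Division by [m0] embeds the multiples of [m0] into the monomials of degree below [a]. *)
Lemma card_monomials_notdiv (m0 : 'X_{1..3}) a :
  (#|{: 'X_{1..3 < a + mdeg m0}}| <= #|{: {m : 'X_{1..3 < a + mdeg m0} | ~~ (m0 <= m)%MM}}| + #|{: 'X_{1..3 < a}}|)%N.
Proof.
rewrite card_sub -(cardC (fun m : 'X_{1..3 < a + mdeg m0} => (m0 <= m)%MM)) addnC leq_add2l.
pose sh (m : 'X_{1..3 < a + mdeg m0}) : 'X_{1..3} := (m - m0)%MM.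
rewrite cardE -(size_map sh).
rewrite [leqRHS]cardE -(size_map (@bmnm 3 a)); apply: uniq_leq_size.
  rewrite map_inj_in_uniq ?enum_uniq // => x y; rewrite !mem_enum /in_mem /= => mx my.
  rewrite /sh => exy; apply/val_inj => /=.
  by rewrite -(submK mx) exy submK.
move=> y /mapP[x]; rewrite mem_enum /in_mem /= => mx ->.
have lt_s : (mdeg (sh x) < a)%N.
  by rewrite -(ltn_add2r (mdeg m0)) -mdegD submK ?bmdeg.
by apply/mapP; exists (BMultinom lt_s); rewrite ?mem_enum.
Qed.

(** The [h]'s count monomials of degree below n^2 + d + e, n^2 + d, n^2 + e and n^2; their
    alternating sum is about e d n^2. As e d + 1 <= n, the product on the right has a surplus of n^2
    + 1, which outweighs the n^2 lost through the subtraction of n. *)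
Lemma bezout_arith (e d n h0 h1 h2 h3 : nat) :
  (6 * h0 = (n ^ 2 + d + e) * (n ^ 2 + d + e).+1 * (n ^ 2 + d + e).+2 ->
   6 * h1 = (n ^ 2 + d) * (n ^ 2 + d).+1 * (n ^ 2 + d).+2 ->
   6 * h2 = (n ^ 2 + e) * (n ^ 2 + e).+1 * (n ^ 2 + e).+2 ->
   6 * h3 = n ^ 2 * (n ^ 2).+1 * (n ^ 2).+2 ->
   e * d < n -> h0 + h3 < h1 + h2 + n * (n ^ 2 + d + e - n).+1)%N.
Proof.
move=> H0 H1 H2 H3 lt_n.
have n0 : (0 < n)%N by apply: leq_ltn_trans lt_n.
have le_n : (n <= n ^ 2)%N by rewrite -[leqLHS]expn1 leq_pexp2l.
have T_n : (n ^ 2 = n * n)%N by rewrite expnS expn1.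
move: (n ^ 2)%N H0 H1 H2 H3 le_n T_n => T H0 H1 H2 H3 le_n T_n.
have E : (6 * (h0 + h3) = 6 * (h1 + h2) + 6 * (e * d * T.+1) + 3 * (e * d * (e + d)))%N.
  by rewrite !mulnDr H0 H1 H2 H3; clear; lia.
have -> : ((T + d + e - n).+1 = (T.+1 - n) + (d + e))%N by move: le_n; clear; lia.
rewrite mulnDr mulnBr -T_n.
have : ((e * d).+1 * T.+1 <= n * T.+1)%N by rewrite leq_mul2r lt_n orbT.
have : (e * d * (d + e) <= n * (d + e))%N by rewrite leq_mul2r (ltnW lt_n) orbT.
rewrite (addnC d e) mulSn; move: E {H0 H1 H2 H3 T_n lt_n}.
move: (e * d * (e + d))%N (e * d * T.+1)%N (n * T.+1)%N  (n * (e+d))%N => *.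
lia.
Qed.

(* Bezout by dimension count: multiples of [g], multiples of [f] by polynomials
   reduced modulo the leading monomial of [g], and, for each line, polynomials
   vanishing on the other lines, are linearly independent. *)
Lemma dvd_of_common_lines g f (S : seq (K * K * K)) :
  prime_elt g -> uniq S ->
  (forall l, l \in S -> restrict l g = 0 /\ restrict l f = 0) ->
  ((msize g).-1 * (msize f).-1 < size S)%N -> divides g f.
Proof.
move=> [g0 gU gM] uS Slines ltS; apply: boolp.contrapT => ndiv.
have f0 : f != 0 by apply/eqP => f0; apply: ndiv; exists 0; rewrite f0 mulr0.
set e := (msize g).-1 in ltS; set d := (msize f).-1 in ltS; set n := size S in ltS.
have eE : msize g = e.+1 by rewrite /e (mpolySpred _ g0).
have dE : msize f = d.+1 by rewrite /d (mpolySpred _ f0).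
have leadE : mdeg (mlead g) = e by apply: succn_inj; rewrite mlead_deg.
pose t := (n ^ 2 + d + e)%N.
pose I1 := 'X_{1..3 < n ^ 2 + d}.
pose I2 := {m : 'X_{1..3 < n ^ 2 + e} | ~~ (mlead g <= m)%MM}.
pose I3 := ('I_n * 'I_(t - n).+1)%type.
have [sep sepP] : exists sep : K * K * K -> K * K * K -> {mpoly K[3]}, forall l l', 
    (msize (sep l l') <= 2)%N /\
    (l != l' -> restrict l' (sep l l') = 0 /\ restrict l (sep l l') != 0).
  have h l l' : exists s, (msize s <= 2)%N /\
      (l != l' -> restrict l' s = 0 /\ restrict l s != 0).
    have [->|/separating_plane[s [? ? ?]]] := eqVneq l l'; last by exists s.
    by exists 0; rewrite msize0.
  have [sp spP] := boolp.choice (fun ll => h ll.1 ll.2).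
  by exists (fun l l' => sp (l, l')) => l l'; apply: (spP (l, l')).
pose li (i : 'I_n) := nth (0, 0, 0) S i.
have liP i : li i \in S by apply: mem_nth.
have liI i j : i != j -> li i != li j by move=> nij; rewrite nth_uniq.
(* [Q i] vanishes on every line of [S] but the i-th. Its degree is at most [n - 1], which leaves the
   powers of ['X_i2] up to [t - n]. *)
pose Q (i : 'I_n) := \prod_(j < n | j != i) sep (li i) (li j).
pose v (x : (I1 + I2) + I3) : {mpoly K[3]} :=
  match x with
  | inl (inl m) => 'X_[m] * g
  | inl (inr m) => 'X_[val m] * f
  | inr (i, j) => 'X_i2 ^+ j * Q i
  end.
(* There are more products [v x] than monomials of degree below [t]. *)
have [|u [[x0 ux0] usum]] := @linear_dependence K ((I1 + I2) + I3)%type 'X_{1..3 < t}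
  (fun x (m : 'X_{1..3 < t}) => (v x)@_m).
  have h3 : (#|{: I3}| = n * (t - n).+1)%N by rewrite card_prod !card_ord.
  have := card_monomials_notdiv (mlead g) (n ^ 2); rewrite leadE => h2.
  rewrite !card_sum h3 -(ltn_add2r #|{: 'X_{1..3 < n ^ 2}}|).
  apply: leq_trans (bezout_arith (e := e) (d := d) (n := n)
    (card_bounded_monomials6 _) (card_bounded_monomials6 _) (card_bounded_monomials6 _)
    (card_bounded_monomials6 _) ltS) _.
  by rewrite [leqRHS]addnAC leq_add2r -addnA leq_add2l.
have le_n : (n <= n ^ 2)%N.
  by rewrite -[leqLHS]expn1 leq_pexp2l //; apply: leq_ltn_trans ltS.
have n0 : (0 < n)%N by apply: leq_ltn_trans ltS.
have sizeQ i : (msize (Q i) <= n)%N.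
  apply: leq_trans (msize_prod_le _ _ _) _ => [j|]; first by have [] := sepP (li i) (li j).
  by rewrite -sum1_count sum1_card cardC1 card_ord prednK.
have sizeXn j : (msize ('X_i2 ^+ j : {mpoly K[3]}) <= j.+1)%N.
  by rewrite mpolyXn msizeX mdegMn mdeg1 mul1n.
have szv x : (msize (v x) <= t)%N.
  case: x => [[m|m]|[i j]] /=; apply: leq_trans (msize_mul_leq _ _) _.
  - by rewrite msizeX eE addSn /= addnS -addSn /t leq_add2r; apply: bmdeg.
  - by rewrite msizeX dE addSn /= addnS -addSn /t addnAC leq_add2r; apply: bmdeg.
  - rewrite -subn1 leq_subLR add1n.
    have lt_j := leq_trans (sizeXn j) (ltn_ord j).
    apply: leq_trans (leq_add lt_j (sizeQ i)) _; rewrite addSn subnK //.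
    by rewrite /t -addnA (leq_trans le_n) ?leq_addr.
have vsum : \sum_x u x *: v x = 0.
  apply/mpolyP => m; rewrite mcoeff0 raddf_sum /=.
  have [lt_m|le_m] := ltnP (mdeg m) t.
    rewrite -[RHS](usum (BMultinom lt_m)); apply: eq_bigr => x _.
    by rewrite mcoeffZ.
  apply: big1 => x _; rewrite mcoeffZ (memN_msupp_eq0 (p := v x)) ?mulr0 //.
  by apply: msize_mdeg_ge; apply: leq_trans (szv x) le_m.
rewrite big_sumType big_sumType /= in vsum.
pose a := \sum_(m : I1) u (inl (inl m)) *: 'X_[m] : {mpoly K[3]}.
pose c := \sum_(m : I2) u (inl (inr m)) *: 'X_[val m] : {mpoly K[3]}.
pose r (i : 'I_n) := \sum_(j < (t - n).+1) u (inr (i, j)) *: 'X_i2 ^+ j : {mpoly K[3]}.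
have {}vsum : a * g + c * f + \sum_i r i * Q i = 0.
  rewrite -[RHS]vsum; congr (_ + _ + _).
  - by rewrite mulr_suml; apply: eq_bigr => m _; rewrite scalerAl.
  - by rewrite mulr_suml; apply: eq_bigr => m _; rewrite scalerAl.
  - rewrite [RHS](eq_bigr (fun p => u (inr (p.1, p.2)) *: ('X_i2 ^+ p.2 * Q p.1))); last by case.
    rewrite -(pair_bigA _ (fun i j => u (inr (i, j)) *: ('X_i2 ^+ j * Q i))) /=.
    by apply: eq_bigr => i _; rewrite mulr_suml; apply: eq_bigr => m _; rewrite scalerAl.
(* On the i-th line only [r i * Q i] survives and [Q i] is nonzero; ['X_i2] restricts to the
   parameter, so the coefficients of [r i] all vanish. *)
have u3 i j : u (inr (i, j)) = 0.
  have : restrict (li i) (r i) * restrict (li i) (Q i) = 0.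
    have [rg rf] := Slines _ (liP i).
    have /(congr1 (restrict (li i))) := vsum.
    rewrite !restrictD !restrictM rg rf !mulr0 !add0r restrict0 => vs.
    rewrite -[RHS]vs [RHS](big_morph _ (restrictD _) (restrict0 _)) [RHS](bigD1 i) //= restrictM.
    rewrite big1 ?addr0 // => k nki.
    have Qk0 : restrict (li i) (Q k) = 0.
      have [_ /(_ (liI _ _ nki))[s0 _]] := sepP (li k) (li i).
      by rewrite /Q (bigD1 i) 1?eq_sym //= restrictM s0 mul0r.
    by rewrite restrictM Qk0 mulr0.
  have Qn0 : restrict (li i) (Q i) != 0.
    rewrite /Q (big_morph _ (restrictM _) (rmorph1 (restrict (li i)))).
    apply/prodf_neq0 => k nki; have [_ /(_ _)[]//] := sepP (li i) (li k).
    by apply: liI; rewrite eq_sym.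
  move/eqP; rewrite mulf_eq0 (negPf Qn0) orbF => /eqP.
  rewrite /r (big_morph _ (restrictD _) (restrict0 _)) => /polyP/(_ j).
  rewrite coef0 coef_sum => rj; rewrite -[RHS]rj (bigD1 j) //=.
  have resX k : restrict (li i) ('X_i2 ^+ k) = 'X^k.
    by rewrite rmorphXn /= restrictX; case: (li i) => [[? ?] ?].
  rewrite restrictZ resX coefZ coefXn eqxx mulr1 big1 ?addr0 // => k nkj.
  by rewrite restrictZ resX coefZ coefXn val_eqE eq_sym (negPf nkj) mulr0.
have {}vsum : a * g + c * f = 0.
  rewrite -[RHS]vsum (big1 _ _ (fun i => r i * Q i)) ?addr0 // => i _.
  by rewrite /r big1 ?mul0r // => j _; rewrite u3 scale0r.
have ccoef (m : I2) : c@_(bmnm (val m)) = u (inl (inr m)).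
  rewrite /c raddf_sum (bigD1 m) //= mcoeffZ mcoeffX eqxx mulr1 big1 ?addr0 // => k nkm.
  by rewrite mcoeffZ mcoeffX !val_eqE (negPf nkm) mulr0.
have acoef (m : I1) : a@_(bmnm m) = u (inl (inl m)).
  rewrite /a raddf_sum (bigD1 m) //= mcoeffZ mcoeffX eqxx mulr1 big1 ?addr0 // => k nkm.
  by rewrite mcoeffZ mcoeffX val_eqE (negPf nkm) mulr0.
(* The prime [g] does not divide [f], so it divides [c]; but a nonzero multiple of [g] has leading
   monomial divisible by [mlead g], and [c] contains no such monomial. *)
have c0 : c = 0.
  have /gM[[h ch]|//] : divides g (c * f).
    by exists (- a); rewrite mulrN; apply/eqP; rewrite -addr_eq0 addrC (mulrC g) vsum.
  apply/eqP; apply: contraT => cn0.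
  have hn0 : h != 0 by apply: contra_neq cn0 => h0; rewrite ch h0 mulr0.
  have := mlead_supp cn0; rewrite mcoeff_msupp /c raddf_sum /= => /eqP[]; apply: big1 => m _.
  rewrite -/c mcoeffZ mcoeffX; case: eqP => [em|_]; last by rewrite mulr0.
  have := valP m; rewrite em ch mleadM // => /negP[]; apply/mnm_lepP => i.
  by rewrite mnmDE leq_addr.
have a0 : a = 0.
  by apply/eqP; move/eqP: vsum; rewrite c0 mul0r addr0 mulf_eq0 (negPf g0) orbF.
case/negP: ux0; apply/eqP; case: x0 => [[m|m]|[i j]]; last exact: u3.
  by rewrite -acoef a0 mcoeff0.
by rewrite -ccoef c0 mcoeff0.
Qed.
End Bezout.

(** * A polynomial of low degree vanishing on all lines *)

Section RandomOrder.
Local Open Scope nat_scope.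
Variable T : finType.
Implicit Types (s : {perm T}) (S : {set T}) (u v w : T).

Definition rank s v : nat := enum_rank (s v).

Definition position s S v := #|[set u in S | rank s u < rank s v]|.

Lemma position_inj s S : {in S &, injective (position s S)}.
Proof.
suff lt v w : v \in S -> rank s v < rank s w -> position s S v < position s S w.
  move=> v w vS wS; case: (ltngtP (rank s v) (rank s w)) => [/lt|/lt|].
  - by move=> /(_ vS) lt_p e; rewrite e ltnn in lt_p.
  - by move=> /(_ wS) lt_p e; rewrite e ltnn in lt_p.
  - by move=> /val_inj/enum_rank_inj/perm_inj.
move=> vS lt_vw; apply: proper_card; apply/properP; split.
  by apply/subsetP => u; rewrite !inE => /andP[-> /= /ltn_trans->].
by exists v; rewrite !inE vS ?lt_vw // ltnn.
Qed.

(** The transposition preserves [S] and exchanges the ranks of [v] and [w], so [w] takes over the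
    place of [v]. *)
Lemma position_tperm s S v w : v \in S -> w \in S ->
  position (tperm v w * s)%g S w = position s S v.
Proof.
move=> vS wS; rewrite /position -(card_imset _ (@perm_inj _ (tperm v w))).
apply: eq_card => u; rewrite -[u](tpermK v w) (mem_imset _ _ (@perm_inj _ _)).
move: (tperm v w u) => x; rewrite !inE /rank !permM tpermR; congr (_ && _).
by case: tpermP => [->|->|]; rewrite ?vS ?wS.
Qed.

(** Positions within [S] are distinct, so each value [i] contributes [d.+1 - i] at most once. *)
Lemma sum_position_le s S d :
  2 * \sum_(w in S) (d.+1 - position s S w) <= d.+1 * d.+2.
Proof.
have -> : d.+1 * d.+2 = 2 * \sum_(i < d.+1) (d.+1 - i).
  elim: d => [|d IHd]; first by rewrite big_ord1.
  rewrite big_ord_recl /= subn0 mulnDr.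
  by rewrite (eq_bigr (fun i : 'I_d.+1 => d.+1 - i)) // -IHd; lia.
rewrite leq_mul2l /=.
apply: leq_trans (_ : \sum_(w in S) \sum_(i < d.+1 | i == position s S w :> nat) (d.+1 - i) <= _).
  apply: leq_sum => w _; case: (ltnP (position s S w) d.+1) => [lt_p|].
    by rewrite (bigD1 (Ordinal lt_p)) //= leq_addr.
  by rewrite -subn_eq0 => /eqP->.
rewrite (exchange_big_dep predT) //=; apply: leq_sum => i _.
rewrite sum_nat_const -[leqRHS]mul1n leq_mul2r; apply/orP; right.
apply/card_le1_eqP => v w /andP[vS /eqP iv] /andP[wS /eqP iw].
by apply: (@position_inj s S) => //; rewrite -iv -iw.
Qed.

(* The position of [v] within [S] is uniform: summing over [S] instead of [v]
   multiplies by [#|S|], and for a fixed order the positions are distinct. *)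
Lemma sum_perm_position S v d : v \in S ->
  2 * #|S| * \sum_(s : {perm T}) (d.+1 - position s S v) <= #|{perm T}| * (d.+1 * d.+2).
Proof.
move=> vS.
have E : #|S| * \sum_s (d.+1 - position s S v)
    = \sum_s \sum_(w in S) (d.+1 - position s S w).
  rewrite exchange_big -sum_nat_const; apply: eq_bigr => w wS.
  rewrite [RHS](reindex_inj (mulgI (tperm v w))) /=.
  by apply: eq_bigr => s _; rewrite position_tperm.
rewrite -mulnA E big_distrr /= -sum_nat_const.
by apply: leq_sum => s _; rewrite sum_position_le.
Qed.
End RandomOrder.

(** * Crossing points and interpolation along lines *)

Section MeetingLines.
Import mpoly.
Variable K : fieldType.
Implicit Types (f g : {mpoly K[3]}) (l : K * K * K).

Definition line_point l s : 'I_3 -> K := fun i => (line_param l i).[s].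

Lemma horner_restrict l f s : (restrict l f).[s] = f.@[line_point l s].
Proof.
rewrite mevalE /restrict /mmap horner_sum; apply: eq_bigr => m _.
rewrite hornerM hornerC /mmap1 horner_prod; congr (_ * _).
by apply: eq_bigr => i _; rewrite horner_exp.
Qed.

(** For lines of distinct directions this vanishes exactly when they meet, see [line_point_meet] and
    [line_point_omega]; the parameter of the common point is then [meet l l']. *)
Definition omega l l' := l'.1.2 - l.1.2 + l.1.1 * l'.2 - l'.1.1 * l.2.

Definition meet l l' := (l.2 - l'.2) / (l.1.1 - l'.1.1).

Lemma line_pointE l s : (line_point l s i0 = l.1.2 - l.1.1 * l.2 + l.1.1 ^+ 2 * s) *
  (line_point l s i1 = l.2 - l.1.1 * s) * (line_point l s i2 = s).
Proof.
by case: l => [[k p] q]; rewrite /line_point /= !hornerE.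
Qed.

Lemma ord3_cases (P : 'I_3 -> Prop) : P i0 -> P i1 -> P i2 -> forall i, P i.
Proof.
move=> P0 P1 P2 [[|[|[|//]]] lt_i]; [move: P0|move: P1|move: P2];
  by congr P; apply: val_inj.
Qed.

Lemma line_point_meet l l' : l.1.1 != l'.1.1 -> omega l l' = 0 ->
  line_point l (meet l l') =1 line_point l' (meet l l').
Proof.
rewrite -subr_eq0 /omega => nk om.
have mE : (l.1.1 - l'.1.1) * meet l l' = l.2 - l'.2 by rewrite mulrC divfK.
have pE : l.1.2 = l'.1.2 + l.1.1 * l'.2 - l'.1.1 * l.2.
  by apply/eqP; rewrite -subr_eq0; apply/eqP; rewrite -oppr0 -om; ring.
have mE0 : (l.1.1 - l'.1.1) * meet l l' - (l.2 - l'.2) = 0 by rewrite mE subrr.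
apply: ord3_cases; rewrite !line_pointE //; apply/eqP; rewrite -subr_eq0.
  rewrite pE [X in X == 0](_ : _ = (l.1.1 + l'.1.1) * 0); first by rewrite mulr0.
  by rewrite -mE0; ring.
rewrite [X in X == 0](_ : _ = - 0); first by rewrite oppr0.
by rewrite -mE0; ring.
Qed.

Lemma line_point_omega l l' s s' :
  line_point l s =1 line_point l' s' -> omega l l' = 0.
Proof.
move=> e; have := e i2; have := e i1; have := e i0; rewrite !line_pointE /omega.
move=> /eqP; rewrite -subr_eq0 => /eqP e0 /eqP; rewrite -subr_eq0 => /eqP e1 es.
rewrite -es in e0 e1.
transitivity (- 0 + (l.1.1 + l'.1.1) * - 0 : K); last by rewrite !oppr0 mulr0 addr0.
by rewrite -[X in - X + _]e0 -[X in _ * - X]e1; ring.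
Qed.

Section Vanishing.
Variables (T : finType) (L : T -> K * K * K) (e : rel T).
Hypothesis e_meet : forall u v, e u v -> (L u).1.1 != (L v).1.1 /\ omega (L u) (L v) = 0.
Hypothesis e_skew : forall u v w, e u v -> e u w -> v != w -> omega (L v) (L w) != 0.

(** Two neighbours through the same point of [u] would meet each other, against [e_skew]. *)
Lemma meet_inj u : {in e u &, injective (fun v => meet (L u) (L v))}.
Proof.
move=> v w uv uw evw; apply/eqP; apply: contraT => nvw.
have [kv ov] := e_meet uv; have [kw ow] := e_meet uw.
have /eqP[] := e_skew uv uw nvw.
apply: (@line_point_omega _ _ (meet (L u) (L v)) (meet (L u) (L v))) => i.
by rewrite -line_point_meet // {2}evw evw -line_point_meet.
Qed.

Lemma root_restrict_meet f u v : e u v -> restrict (L v) f = 0 ->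
  root (restrict (L u) f) (meet (L u) (L v)).
Proof.
move=> /e_meet[kuv ouv] fv; rewrite rootE horner_restrict.
by rewrite (meval_eq _ (line_point_meet kuv ouv)) -horner_restrict fv horner0.
Qed.

(* In a random order of the lines, those meeting a given line precede it in
   uniformly distributed number, so on average few coefficients of the
   restriction of [f] remain to be killed by linear algebra. *)
Lemma vanishing_polynomial (r d : nat) :
  (forall v, r <= #|[set u | e v u]|)%N -> (3 * #|T| < r.+1 * (d + 3))%N ->
  exists f, [/\ f != 0, (msize f <= d.+1)%N & forall v, restrict (L v) f = 0].
Proof.
move=> degr ltT; pose N v := [set u | e v u].
(* [v] is joined to its neighbourhood so that its position is uniform among at least [r.+1]
   places. *)
pose prev s v := position s (v |: N v) v.
have prevE s v : prev s v = #|[set u in N v | (rank s u < rank s v)%N]|.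
  apply: eq_card => u; rewrite !inE; case: eqP => //= ->.
  by rewrite ltnn andbF.
have nN v : v \notin N v.
  rewrite inE; apply/negP => /e_meet[]; by rewrite eqxx.
(* An order with the fewest conditions does at least as well as the average one. *)
have [s small] : exists s : {perm T},
    (2 * r.+1 * \sum_v (d.+1 - prev s v) <= #|T| * (d.+1 * d.+2))%N.
  have [s0 _ s0min] := arg_minnP (fun s : {perm T} => (\sum_v (d.+1 - prev s v))%N)
    (erefl (xpredT (1%g : {perm T}))).
  exists s0; set m := (\sum_v (d.+1 - prev s0 v))%N in s0min *.
  have perm_gt0 : (0 < #|{perm T}|)%N by apply/card_gt0P; exists 1%g.
  rewrite -(leq_pmul2l perm_gt0) mulnCA -sum_nat_const.
  apply: leq_trans (_ : 2 * r.+1 * \sum_(s : {perm T}) \sum_v (d.+1 - prev s v) <= _)%N.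
    by rewrite leq_mul2l /=; apply: leq_sum => s _; apply: s0min.
  rewrite exchange_big /= big_distrr /= mulnCA -sum_nat_const.
  apply: leq_sum => v _.
  apply: leq_trans (@sum_perm_position _ (v |: N v) v d (setU11 _ _)).
  by rewrite leq_mul // leq_mul // cardsU1 nN add1n ltnS; apply: degr.
(* The linear conditions: on each line [v], the coefficients of index [prev s v] to [d] of the
   restriction vanish. *)
pose J := {x : T * 'I_d.+1 | (prev s x.1 <= x.2)%N}.
have cardJ : #|{: J}| = (\sum_v (d.+1 - prev s v))%N.
  rewrite card_sub -sum1_card.
  rewrite (eq_bigl (fun x : T * 'I_d.+1 => true && (prev s x.1 <= x.2)%N)) //.
  rewrite -(pair_big_dep xpredT (fun v (i : 'I_d.+1) => (prev s v <= i)%N) (fun _ _ => 1%N)) /=.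
  have count n c : (\sum_(i < n | c <= i) 1 = n - c)%N.
    elim: n => [|n IHn]; first by rewrite big_ord0.
    by rewrite big_mkcond big_ord_recr -big_mkcond IHn /=; case: leqP; lia.
  by apply: eq_bigr => v _; apply: count.
(* C(d+3, 3) monomials stand against at most |T| (d+1) (d+2) / (2 (r+1)) conditions. *)
have [|u [[m0 um0] uJ]] := @linear_dependence K 'X_{1..3 < d.+1} J
  (fun m x => (restrict (L (val x).1) 'X_[m])`_(val x).2).
  rewrite cardJ.
  have := card_bounded_monomials6 d.+1; move: small.
  move: (\sum_v _)%N #|T| ltT #|{: 'X_{1..3 < d.+1}}| => c t lt_t M le_c M6.
  rewrite ltnNge; apply/negP => le_M.
  have h1 : (r.+1 * (6 * M) <= r.+1 * (6 * c))%N by rewrite !leq_mul2l le_M !orbT.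
  have h2 : (3 * t * (d.+1 * d.+2) < r.+1 * (d + 3) * (d.+1 * d.+2))%N.
    by rewrite ltn_pmul2r.
  rewrite M6 in h1.
  have : (r.+1 * (6 * c) <= 3 * t * (d.+1 * d.+2))%N.
    by move: le_c; clear; rewrite -[(3 * t * _)%N]mulnA; move: (t * _)%N => x; lia.
  move: h1 h2; rewrite (_ : r.+1 * (d + 3) * _ = r.+1 * (d.+1 * d.+2 * d.+3))%N; last by clear; lia.
  by clear; lia.
exists (\sum_m u m *: 'X_[bmnm m]); set f := \sum_m _.
have fm m : f@_(bmnm m) = u m.
  rewrite /f raddf_sum (bigD1 m) //= mcoeffZ mcoeffX eqxx mulr1 big1 ?addr0 // => k nkm.
  by rewrite mcoeffZ mcoeffX val_eqE (negPf nkm) mulr0.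
have szf : (msize f <= d.+1)%N.
  apply: leq_trans (msize_sum _ _ _) _; apply/bigmax_leqP => m _.
  by rewrite (leq_trans (msizeZ_le _ _)) // msizeX bmdeg.
split=> //; first by apply: contra_neq um0 => f0; rewrite -fm f0 mcoeff0.
have fcoef v (i : nat) : (prev s v <= i)%N -> (restrict (L v) f)`_i = 0.
  move=> le_i; case: (ltnP i d.+1) => [lt_i|ge_i]; last first.
    by rewrite nth_default // (leq_trans (size_restrict _ _)) // (leq_trans szf).
  have := uJ (Sub (v, Ordinal lt_i) le_i : J); rewrite SubK /= => sum0.
  rewrite -[RHS]sum0 /f (big_morph _ (restrictD _) (restrict0 _)) coef_sum.
  by apply: eq_bigr => m _; rewrite restrictZ coefZ.
(* Induction along the order: the restriction to [v] has size at most [prev s v] and vanishes at the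
   distinct points where the [prev s v] earlier neighbours cross. *)
move=> v; move: {2}(rank s v) (leqnn (rank s v)) => n.
elim/ltn_ind: n v => n IHn v le_v.
have [//|nz] := eqVneq (restrict (L v) f) 0.
pose rs := [seq meet (L v) (L w) | w <- enum [set w in N v | (rank s w < rank s v)%N]].
have := max_poly_roots nz (rs := rs); rewrite size_map -cardE -prevE.
have -> : all (root (restrict (L v) f)) rs.
  apply/allP => x /mapP[w]; rewrite mem_enum !inE => /andP[vw lt_w] ->.
  apply: root_restrict_meet => //; apply: IHn (leqnn _).
  exact: leq_trans lt_w le_v.
rewrite map_inj_in_uniq ?enum_uniq; last first.
  by move=> w w'; rewrite !mem_enum !inE => /andP[vw _] /andP[vw' _]; apply: meet_inj.
move=> /(_ isT isT); rewrite ltnNge => /negP[].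
by apply/leq_sizeP => i; apply: fcoef.
Qed.
End Vanishing.
End MeetingLines.

(** * Umbilic surfaces *)

Section Wronskian.
Variables (K : fieldType) (p : nat).
Hypothesis pK : p \in [pchar K].

Lemma natr_inj_lt_char a b : (a < p)%N -> (b < p)%N -> a%:R = b%:R :> K -> a = b.
Proof.
wlog le_ab : a b / (a <= b)%N.
  by move=> h lt_a lt_b e; case: (leqP a b) => [/h|/ltnW/h]; [apply|move=> h'; apply/esym/h'].
move=> _ lt_b /esym/eqP; rewrite -subr_eq0 -natrB // -(dvdn_pcharf pK) => dv.
have : (b - a < p)%N by lia.
by case: (posnP (b - a)) => [|gt0 lt_p]; [lia | have := dvdn_leq gt0 dv; lia].
Qed.

Lemma coef_mul_top (R : nzRingType) (f h : {poly R}) m n :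
  (size f <= m.+1)%N -> (size h <= n.+1)%N -> (f * h)`_(m + n) = f`_m * h`_n.
Proof.
move=> sf sh; rewrite coefM.
have lt_m : (m < (m + n).+1)%N by rewrite ltnS leq_addr.
rewrite (bigD1 (Ordinal lt_m)) //= addKn big1 ?addr0 // => i.
rewrite -val_eqE /= neq_ltn => /orP[lt_i|gt_i].
  by rewrite [h`__]nth_default ?mulr0 // (leq_trans sh) //; have := ltn_ord i; lia.
by rewrite nth_default ?mul0r // (leq_trans sf).
Qed.

(** A multiple of [h] is subtracted from [f] to kill the coefficient at the degree of [h]. If the
    difference is nonzero, the top coefficients of the Wronskian identity make the two degrees
    congruent modulo [p], hence equal, a contradiction. *)
Lemma wronskian_eq0 (f h : {poly K}) :
  (size f <= p)%N -> (size h <= p)%N -> h != 0 -> f^`() * h = f * h^`() ->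
  exists c, f = c *: h.
Proof.
move=> sf sh h0 e; set b := (size h).-1.
have sb : size h = b.+1 by rewrite prednK // size_poly_gt0.
exists (f`_b / lead_coef h); set c := _ / _.
apply/eqP; rewrite -subr_eq0; set f1 := f - _; apply: contraT => f10.
have e1 : f1^`() * h = f1 * h^`().
  by rewrite derivB derivZ mulrBl mulrBl e -!scalerAl (mulrC h).
have s1 : (size f1 <= p)%N.
  by rewrite (leq_trans (size_polyD _ _)) // geq_max sf size_polyN (leq_trans (size_scale_leq _ _)).
set a := (size f1).-1; have sa : size f1 = a.+1 by rewrite prednK // size_poly_gt0.
have cX (q : {poly K}) n : ('X * q^`())`_n = n%:R * q`_n.
  by rewrite coefXM; case: n => [|n]; rewrite ?mul0r //= coef_deriv mulr_natl.
have sX (q : {poly K}) n : (size q <= n.+1)%N -> (size ('X * q^`())%R <= n.+1)%N.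
  by move=> sq; apply/leq_sizeP => j le_j; rewrite cX nth_default ?mulr0 // (leq_trans sq).
have : (('X * f1^`()) * h)`_(a + b) = (f1 * ('X * h^`()))`_(a + b).
  by rewrite -mulrA e1 mulrCA.
rewrite !coef_mul_top ?sX ?sa ?sb // !cX => /eqP.
have fa : f1`_a != 0 by rewrite -lead_coefE lead_coef_eq0.
have hb : h`_b != 0 by rewrite -lead_coefE lead_coef_eq0.
rewrite -subr_eq0 [X in X == 0](_ : _ = (a%:R - b%:R) * (f1`_a * h`_b)); last by ring.
rewrite !mulf_eq0 (negPf fa) (negPf hb) !orbF subr_eq0 => /eqP ab.
have eab : a = b by apply: natr_inj_lt_char ab; lia.
case/negP: fa; rewrite eab coefB coefZ /c -lead_coefE.
by rewrite divfK ?subrr // lead_coef_eq0.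
Qed.

(** With W = - b^2 (A / b)', the equation says that W / b^2 has zero derivative, so A / b is affine.
    The bound [n.*2 <= p] keeps all sizes within reach of [wronskian_eq0]. *)
Lemma deriv_fraction_const (A b : {poly K}) n :
  (0 < n)%N -> (n.*2 <= p)%N -> (size A <= n)%N -> (size b <= n)%N -> b != 0 ->
  b * (A * b^`() - A^`() * b)^`() = 2%:R * (A * b^`() - A^`() * b) * b^`() ->
  exists x y, A = (x%:P + y *: 'X) * b.
Proof.
move=> n0 le_p sA sb b0; set W := A * _ - _ => eW.
have sd (f : {poly K}) : (size f <= n)%N -> (size f^`() <= n)%N.
  move=> sf; have [->|f0] := eqVneq f 0; first by rewrite linear0 size_poly0.
  by rewrite (leq_trans (ltnW (lt_size_deriv f0))).
have sM (f h : {poly K}) : (size f <= n)%N -> (size h <= n)%N -> (size (f * h)%R <= p)%N.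
  by move=> sf sh; rewrite (leq_trans (size_polyMleq _ _)) //; lia.
have sW : (size W <= p)%N.
  by rewrite (leq_trans (size_polyD _ _)) // geq_max size_polyN !sM ?sd.
have [||||y Wy] := @wronskian_eq0 W (b ^+ 2); rewrite ?expf_neq0 ?sM //.
  by rewrite expr2 derivM; transitivity (b * (b * W^`())); [ring|rewrite eW; ring].
have [||||x Ax] := @wronskian_eq0 (A + y *: 'X * b) b => //.
- rewrite (leq_trans (size_polyD _ _)) // geq_max; apply/andP; split; first lia.
  rewrite -scalerAl (leq_trans (size_scale_leq _ _)) // (leq_trans (size_polyMleq _ _)) // size_polyX.
  lia.
- lia.
- rewrite derivD derivM derivZ derivX.
  have : A * b^`() - A^`() * b - y%:P * b ^+ 2 = 0 by rewrite mul_polyC -Wy subrr.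
  rewrite -!mul_polyC => h; apply/eqP; rewrite -subr_eq0; apply/eqP.
  by transitivity (- 0 : {poly K}); [rewrite -h; ring | rewrite oppr0].
exists x, (- y); rewrite mulrDl mul_polyC -Ax scaleNr mulNr; ring.
Qed.
End Wronskian.

(** * Surfaces containing two crossing isotropic lines *)

Section Flatness.
Import mpoly.
Variable K : fieldType.
Implicit Types (f g : {mpoly K[3]}) (l : K * K * K).

(* On the surface [g = 0], seen as a graph [x_0 = phi(x_1, x_2)], these are
   [phi_11], [phi_12], [phi_22] up to the factor [- g_0 ^ 3]; [flat1] and
   [flat2] say that the second fundamental form vanishes on both isotropic
   tangent directions [(t^2, -t, 1)], the roots of [g_0 t^2 - g_1 t + g_2]. *)
Definition flat_xx g : {mpoly K[3]} :=
  g^`M(i1)^`M(i1) * g^`M(i0) ^+ 2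
  - 2%:R * (g^`M(i0)^`M(i1) * g^`M(i0) * g^`M(i1)) + g^`M(i0)^`M(i0) * g^`M(i1) ^+ 2.

Definition flat_xy g : {mpoly K[3]} :=
  g^`M(i1)^`M(i2) * g^`M(i0) ^+ 2 - g^`M(i0)^`M(i1) * g^`M(i0) * g^`M(i2)
  - g^`M(i0)^`M(i2) * g^`M(i0) * g^`M(i1) + g^`M(i0)^`M(i0) * g^`M(i1) * g^`M(i2).

Definition flat_yy g : {mpoly K[3]} :=
  g^`M(i2)^`M(i2) * g^`M(i0) ^+ 2
  - 2%:R * (g^`M(i0)^`M(i2) * g^`M(i0) * g^`M(i2)) + g^`M(i0)^`M(i0) * g^`M(i2) ^+ 2.

Definition flat1 g := 2%:R * flat_xy g * g^`M(i0) - flat_xx g * g^`M(i1).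
Definition flat2 g := flat_yy g * g^`M(i0) - flat_xx g * g^`M(i2).

Lemma line_derivE k f :
  line_deriv k f = k%:MP ^+ 2 * f^`M(i0) - k%:MP * f^`M(i1) + f^`M(i2).
Proof. by rewrite /line_deriv -!mul_mpolyC rmorphXn. Qed.

Lemma line_deriv_mderiv k i f : line_deriv k f^`M(i) = (line_deriv k f)^`M(i).
Proof.
rewrite /line_deriv mderivD mderivB !mderivZ.
by rewrite !(mderiv_comm i).
Qed.

Lemma line_deriv2E k f : line_deriv k (line_deriv k f) =
  k%:MP ^+ 4 * f^`M(i0)^`M(i0) - 2%:R * k%:MP ^+ 3 * f^`M(i0)^`M(i1)
  + k%:MP ^+ 2 * (f^`M(i1)^`M(i1) + 2%:R * f^`M(i0)^`M(i2))
  - 2%:R * k%:MP * f^`M(i1)^`M(i2) + f^`M(i2)^`M(i2).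
Proof.
rewrite line_derivE -!line_deriv_mderiv !line_derivE.
by rewrite (mderiv_comm i1 i0) (mderiv_comm i2 i0) (mderiv_comm i2 i1); ring.
Qed.

Lemma restrict_line_deriv l f : restrict l f = 0 -> restrict l (line_deriv l.1.1 f) = 0.
Proof. by rewrite -restrict_deriv => ->; rewrite linear0. Qed.

Lemma meval_exp (v : 'I_3 -> K) f n : (f ^+ n).@[v] = f.@[v] ^+ n.
Proof. by elim: n => [|n IHn]; rewrite ?expr0 ?meval1 // !exprS mevalM IHn. Qed.

Lemma meval_nat (v : 'I_3 -> K) n : (n%:R : {mpoly K[3]}).@[v] = n%:R.
Proof. by rewrite -mpolyC_nat mevalC. Qed.

Section CrossingLines.
Variables (g : {mpoly K[3]}) (l l' : K * K * K).
Hypotheses (kl : l.1.1 != l'.1.1) (ol : omega l l' = 0).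
Hypotheses (gl : restrict l g = 0) (gl' : restrict l' g = 0).
Let x := line_point l (meet l l').

Let at_l f : restrict l f = 0 -> f.@[x] = 0.
Proof. by move=> fl; rewrite -horner_restrict fl horner0. Qed.

Let at_l' f : restrict l' f = 0 -> f.@[x] = 0.
Proof.
by move=> fl; rewrite (meval_eq _ (line_point_meet kl ol)) -horner_restrict fl horner0.
Qed.

(** Vieta's formulas for the roots k and k' of g_0 t^2 - g_1 t + g_2, obtained by subtraction so
    that g_0 may vanish. *)
Lemma crossing_tangent :
  g^`M(i1).@[x] = (l.1.1 + l'.1.1) * g^`M(i0).@[x] /\
  g^`M(i2).@[x] = l.1.1 * l'.1.1 * g^`M(i0).@[x].
Proof.
have := at_l (restrict_line_deriv gl); have := at_l' (restrict_line_deriv gl').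
rewrite !line_derivE !(mevalD, mevalN, mevalM, mevalC).
move: (g^`M(i0).@[x]) (g^`M(i1).@[x]) (g^`M(i2).@[x]) => a b c e' e.
have d0 : l.1.1 - l'.1.1 != 0 by rewrite subr_eq0.
have eb : b = (l.1.1 + l'.1.1) * a.
  apply: (mulfI d0); apply/eqP; rewrite -subr_eq0; apply/eqP.
  by transitivity (0 - 0 : K); [rewrite -[X in _ = X - _]e' -[X in _ = _ - X]e; ring | rewrite subrr].
split=> //; move: e; rewrite eb => e.
by apply/eqP; rewrite -subr_eq0; apply/eqP; rewrite -[RHS]e; ring.
Qed.

(** The second derivatives of [g] along both lines vanish at [x]. Once [crossing_tangent] has
    eliminated g_1 and g_2, each flatness polynomial times k - k' is a combination of them. *)
Lemma crossing_flat : (flat1 g).@[x] = 0 /\ (flat2 g).@[x] = 0.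
Proof.
have [eb ec] := crossing_tangent.
have := at_l (restrict_line_deriv (restrict_line_deriv gl)).
have := at_l' (restrict_line_deriv (restrict_line_deriv gl')).
rewrite !line_deriv2E /flat1 /flat2 /flat_xx /flat_xy /flat_yy.
rewrite !(mevalD, mevalN, mevalM, meval_exp, meval_nat, mevalC) eb ec.
move: (g^`M(i0).@[x]) (g^`M(i0)^`M(i0).@[x]) (g^`M(i0)^`M(i1).@[x]) (g^`M(i0)^`M(i2).@[x])
  (g^`M(i1)^`M(i1).@[x]) (g^`M(i1)^`M(i2).@[x]) (g^`M(i2)^`M(i2).@[x]).
move=> a h00 h01 h02 h11 h12 h22 q' q.
have d0 : l.1.1 - l'.1.1 != 0 by rewrite subr_eq0.
split; apply: (mulfI d0); rewrite mulr0.
  transitivity (- a ^+ 3 * (0 - 0)); last by rewrite subrr mulr0.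
  by rewrite -[X in _ = _ * (X - _)]q -[X in _ = _ * (_ - X)]q'; ring.
transitivity (a ^+ 3 * (l.1.1 * 0 - l'.1.1 * 0)); last by rewrite !mulr0 subrr mulr0.
by rewrite -[X in _ = _ * (l.1.1 * X - _)]q' -[X in _ = _ * (_ - _ * X)]q; ring.
Qed.
End CrossingLines.
End Flatness.

Section FlatDegree.
Import mpoly.
Variable K : fieldType.
Implicit Types (f g : {mpoly K[3]}) (l : K * K * K).

Lemma msize_mderiv i f : (msize f^`M(i) <= (msize f).-1)%N.
Proof.
rewrite [leqLHS]msizeE big_seq; apply/bigmax_leqP_seq => m; rewrite mcoeff_msupp mcoeff_mderiv => nz _.
have : (m + U_(i))%MM \in msupp f.
  by rewrite mcoeff_msupp; apply: contra_neq nz => ->; rewrite mul0rn.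
move/msize_mdeg_lt; rewrite mdegD mdeg1 addn1 => lt_m.
by rewrite -ltnS (ltn_predK lt_m).
Qed.

Lemma msizeD_leq n f g : (msize f <= n -> msize g <= n -> msize (f + g)%R <= n)%N.
Proof. by move=> sf sg; rewrite (leq_trans (msizeD_le _ _)) // geq_max sf. Qed.

Lemma msizeB_leq n f g : (msize f <= n -> msize g <= n -> msize (f - g)%R <= n)%N.
Proof. by move=> sf sg; apply: msizeD_leq; rewrite ?msizeN. Qed.

Lemma msizeM_leq m n f g :
  (msize f <= m.+1 -> msize g <= n.+1 -> msize (f * g)%R <= (m + n).+1)%N.
Proof. by move=> sf sg; apply: leq_trans (msize_mul_leq _ _) _; lia. Qed.

Lemma msize_nat n : (msize (n%:R : {mpoly K[3]}) <= 1)%N.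
Proof. by rewrite -mpolyC_nat msizeC; case: eqP. Qed.

Lemma msize_flat g e : (msize g <= e.+1)%N ->
  (msize (flat1 g) <= (4 * e).+1)%N /\ (msize (flat2 g) <= (4 * e).+1)%N.
Proof.
move=> sg.
have s1 i f : (msize f <= e.+1 -> msize f^`M(i) <= e.+1)%N.
  by move=> sf; rewrite (leq_trans (msize_mderiv _ _)) // (leq_trans (leq_pred _)).
have sN n f m : (msize f <= m -> msize (n%:R * f)%R <= m)%N.
  by move=> sf; rewrite (leq_trans (msize_mul_leq _ _)) //; have := msize_nat n; lia.
have s3 f1 f2 f3 : (msize f1 <= e.+1 -> msize f2 <= e.+1 -> msize f3 <= e.+1 ->
   msize (f1 * f2 * f3)%R <= (e + e + e).+1)%N.
  by move=> *; apply: msizeM_leq => //; apply: msizeM_leq.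
have s3' f1 f2 : (msize f1 <= e.+1 -> msize f2 <= e.+1 ->
   msize (f1 * f2 ^+ 2)%R <= (e + e + e).+1)%N.
  by move=> *; rewrite expr2 mulrA; apply: s3.
have sxx : (msize (flat_xx g) <= (e + e + e).+1)%N.
  by rewrite /flat_xx; apply: msizeD_leq; [apply: msizeB_leq => //|]; rewrite ?sN ?s3' ?s3 ?s1.
have sxy : (msize (flat_xy g) <= (e + e + e).+1)%N.
  rewrite /flat_xy; apply: msizeD_leq; [apply: msizeB_leq; [apply: msizeB_leq|]|];
    by rewrite ?sN ?s3' ?s3 ?s1.
have syy : (msize (flat_yy g) <= (e + e + e).+1)%N.
  by rewrite /flat_yy; apply: msizeD_leq; [apply: msizeB_leq => //|]; rewrite ?sN ?s3' ?s3 ?s1.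
have -> : (4 * e = e + e + e + e)%N by lia.
by split; apply: msizeB_leq; apply: msizeM_leq; rewrite ?sN ?s1.
Qed.

(** * The differential equation along a line of an umbilic surface *)

Section FlatLine.
Variables (l : K * K * K) (g : {mpoly K[3]}).
Hypotheses (gl : restrict l g = 0).
Hypotheses (d1 : divides g (flat1 g)) (d2 : divides g (flat2 g)).

Let k := l.1.1.
Let A := restrict l g^`M(i0).
Let B := restrict l g^`M(i1).
(** If k' is the second isotropic direction at a point of the line, g_1 = (k + k') g_0 gives b = A
    (k' - k), and W = A^2 (b / A)' measures the variation of k'. *)
Let b := B - 2%:R * k%:P * A.
Let W := A * b^`() - A^`() * b.
Let m := restrict l (flat_xx g).

Let Lg := line_deriv k g.
Let LLg := line_deriv k Lg.

Let rd f : restrict l (line_deriv k f) = (restrict l f)^`().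
Proof. by rewrite restrict_deriv. Qed.

Let Lg0 : restrict l Lg = 0. Proof. by rewrite /Lg rd gl linear0. Qed.
Let LLg0 : restrict l LLg = 0. Proof. by rewrite /LLg rd Lg0 linear0. Qed.

Let restrict_div f : divides g f -> restrict l f = 0.
Proof. by case=> h ->; rewrite restrictM gl mul0r. Qed.

Let restrict_nat n : restrict l n%:R = n%:R.
Proof. by rewrite -mpolyC_nat restrictC -polyC_natr. Qed.

Let restrictN f : restrict l (- f) = - restrict l f.
Proof. exact: rmorphN. Qed.

Let restrict_exp n f : restrict l (f ^+ n) = restrict l f ^+ n.
Proof. exact: rmorphXn. Qed.

(* The tangential derivative [x_1] of the graph [x_0 = phi(x_1, x_2)]. *)
Let D f := g^`M(i0) * f^`M(i1) - g^`M(i1) * f^`M(i0).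

Let DM f h : D (f * h) = D f * h + f * D h.
Proof. by rewrite /D !mderivM; ring. Qed.

Let DB f h : D (f - h) = D f - D h.
Proof. by rewrite /D !mderivB; ring. Qed.

Let DD f h : D (f + h) = D f + D h.
Proof. by rewrite /D !mderivD; ring. Qed.

Let Dn n : D n%:R = 0.
Proof. by rewrite /D -mpolyC_nat !mderivC; ring. Qed.

Let D_div f : divides g f -> restrict l (D f) = 0.
Proof.
case=> h ->; rewrite DM; have -> : D g = 0 by rewrite /D mulrC subrr.
by rewrite mul0r add0r restrictM gl mul0r.
Qed.

Let D_line f : restrict l (D (line_deriv k f)) =
  A * (restrict l f^`M(i1))^`() - B * (restrict l f^`M(i0))^`().
Proof. by rewrite /D -!line_deriv_mderiv restrictD restrictN !restrictM !rd. Qed.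

Let WE : W = A * B^`() - B * A^`().
Proof.
rewrite /W /b derivB derivM [(2%:R * _)^`()]derivM derivC -polyC_natr derivC; ring.
Qed.

(** The identity [E] trades derivatives in x_2 for derivatives along the line. There [Lg] vanishes,
    and [flat1 g] reduces to 2 A^2 W - m b. *)
Lemma flat_line_tangent : 2%:R * A ^+ 2 * W = m * b.
Proof.
have E : flat1 g = 2%:R * g^`M(i0) *
  ((line_deriv k g^`M(i1) - 2%:R * k%:MP * line_deriv k g^`M(i0)) * g^`M(i0) ^+ 2
   - (g^`M(i0)^`M(i1) - 2%:R * k%:MP * g^`M(i0)^`M(i0)) * g^`M(i0) * Lg
   - line_deriv k g^`M(i0) * g^`M(i0) * (g^`M(i1) - 2%:R * k%:MP * g^`M(i0))
   + g^`M(i0)^`M(i0) * (g^`M(i1) - 2%:R * k%:MP * g^`M(i0)) * Lg)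
  - flat_xx g * (g^`M(i1) - 2%:R * k%:MP * g^`M(i0)).
  rewrite /flat1 /flat_xy /flat_xx /Lg !line_derivE.
  rewrite (mderiv_comm i1 i0).
  move: g^`M(i0)^`M(i0) g^`M(i0)^`M(i1) g^`M(i0)^`M(i2) g^`M(i1)^`M(i1) g^`M(i1)^`M(i2).
  move: g^`M(i0) g^`M(i1) g^`M(i2) k%:MP => *.
  by ring.
have [X XE] : exists X, X = flat_xx g by exists (flat_xx g).
have := restrict_div d1; rewrite E -XE.
rewrite !(restrict_nat, restrictC, restrict_exp, Lg0, rd, restrictD, restrictN, restrictM).
rewrite -/A -/B XE -/m => h; apply/eqP; rewrite -subr_eq0; apply/eqP; rewrite -[RHS]h.
by rewrite WE /b; ring.
Qed.

(** Every term of [flat2 g - k flat1 g] contains [Lg] or [LLg], so its vanishing on the line says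
    nothing. The information lies in its derivative [D], which vanishes there too because
    [D g = 0]. *)
Lemma flat_line_derivative : A ^+ 2 * (A * W^`() - 2%:R * A^`() * W) = m * W.
Proof.
have E : flat2 g - k%:MP * flat1 g =
    (LLg * g^`M(i0) ^+ 2 - 2%:R * (line_deriv k g^`M(i0) * g^`M(i0) * Lg)
     + g^`M(i0)^`M(i0) * (Lg * Lg)) * g^`M(i0) - flat_xx g * Lg.
  rewrite /flat2 /flat1 /flat_yy /flat_xy /flat_xx /LLg /Lg line_deriv2E !line_derivE.
  move: g^`M(i0)^`M(i0) g^`M(i0)^`M(i1) g^`M(i0)^`M(i2) g^`M(i1)^`M(i1) g^`M(i1)^`M(i2).
  move: g^`M(i2)^`M(i2) g^`M(i0) g^`M(i1) g^`M(i2) k%:MP => *.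
  by ring.
have dv : divides g (flat2 g - k%:MP * flat1 g).
  by case: d1 d2 => [h1 ->] [h2 ->]; exists (h2 - k%:MP * h1); rewrite mulrBr mulrCA.
have DL : restrict l (D Lg) = W by rewrite D_line -/A -/B WE.
have DLL : restrict l (D LLg) = W^`().
  by rewrite D_line WE derivB !derivM -!line_deriv_mderiv !rd -/A -/B; ring.
(* Only the terms where [D] falls on the sole vanishing factor survive. *)
have aux Y P P0 H X0 X : restrict l Y = 0 -> restrict l P = 0 ->
    restrict l (D ((Y * P0 ^+ 2 - 2%:R * (H * P0 * P) + X0 * (P * P)) * P0 - X * P)) =
    (restrict l (D Y) * restrict l P0 ^+ 2
     - 2%:R * (restrict l H * restrict l P0 * restrict l (D P))) * restrict l P0
    - restrict l X * restrict l (D P).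
  move=> Y0 P_0; rewrite expr2 !(DB, DD, DM, Dn).
  rewrite !(restrict_nat, restrict0, restrictD, restrictN, restrictM, Y0, P_0).
  by ring.
have := D_div dv; rewrite E aux // DL DLL rd -/A -/m => h.
apply/eqP; rewrite -subr_eq0; apply/eqP; rewrite -[RHS]h.
by ring.
Qed.

(** Eliminating m from the two identities gives b (A W' - 2 A' W) = 2 W^2, which is A times the
    equation b W' = 2 W b' of [deriv_fraction_const]. *)
Lemma flat_line_fraction p : p \in [pchar K] -> (2 * (msize g).-1 <= p)%N ->
  A != 0 -> b != 0 -> exists x y, A = (x%:P + y *: 'X) * b.
Proof.
move=> pK le_p A0 b0.
have sA i : (size (restrict l g^`M(i)) <= (msize g).-1)%N.
  by rewrite (leq_trans (size_restrict _ _)) ?msize_mderiv.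
apply: (deriv_fraction_const pK (n := (msize g).-1)) => //.
- by rewrite lt0n; apply: contraNneq A0 => e0; rewrite -size_poly_leq0 -e0 sA.
- by rewrite -mul2n.
- by rewrite sA.
- rewrite (leq_trans (size_polyD _ _)) // geq_max size_polyN sA -polyC_natr -polyCM mul_polyC.
  by rewrite (leq_trans (size_scale_leq _ _)) ?sA.
have A2 : A ^+ 2 != 0 by rewrite expf_neq0.
rewrite -/W; apply: (mulfI A0).
have h : b * (A * W^`() - 2%:R * A^`() * W) = 2%:R * W ^+ 2.
  apply: (mulfI A2); rewrite mulrCA flat_line_derivative.
  transitivity (m * b * W); first by ring.
  by rewrite -flat_line_tangent; ring.
transitivity (b * (A * W^`() - 2%:R * A^`() * W) + 2%:R * A^`() * W * b); first by ring.
by rewrite h /W; ring.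
Qed.
End FlatLine.
End FlatDegree.

(** * Rich configurations of lines *)

Section RichConfiguration.
Import mpoly.
Variables (K : fieldType) (p : nat).
Hypothesis pK : p \in [pchar K].
Implicit Types (f g h : {mpoly K[3]}) (l : K * K * K).

Lemma msize_nonunit f : f != 0 -> f \isn't a GRing.unit -> (1 < msize f)%N.
Proof.
move=> f0 fU; rewrite ltnNge; apply: contra fU => /msize1_polyC fE.
by rewrite fE; apply: rmorph_unit; rewrite unitfE; apply: contra_neq f0 => c0;
  rewrite fE c0 mpolyC0.
Qed.

Lemma msize_unit f : f \is a GRing.unit -> msize f = 1%N.
Proof.
move=> fU; have f0 : f != 0 by apply: contraTneq fU => ->; rewrite unitr0.
have fV0 : f^-1 != 0 by rewrite invr_eq0.
have := msizeM f0 fV0; rewrite divrr // msize1 (mpolySpred _ f0) (mpolySpred _ fV0); lia.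
Qed.

Lemma divides_msize g h : divides g h -> h != 0 -> (msize g <= msize h)%N.
Proof.
move=> [c ->]; rewrite mulf_eq0 negb_or => /andP[g0 c0].
by rewrite msizeM // (mpolySpred _ c0) addnS leq_addr.
Qed.

Lemma deriv_eq0_const g : (msize g <= p)%N -> (forall i, g^`M(i) = 0) -> (msize g <= 1)%N.
Proof.
move=> le_p g'0; rewrite [leqLHS]msizeE big_seq; apply/bigmax_leqP_seq => m mg _.
have lt_m := leq_trans (msize_mdeg_lt mg) le_p.
rewrite ltnS leqn0 mdeg_eq0; apply/eqP/mnmP => i; rewrite mnm0E.
apply/eqP; apply: contraT; rewrite -lt0n => mi0.
have mE : (m - U_(i) + U_(i) = m)%MM.
  by apply: submK; apply/mnm_lepP => j; rewrite mnm1E; case: eqP => [<-|].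
have : (g^`M(i))@_(m - U_(i)) = 0 by rewrite g'0 mcoeff0.
rewrite mcoeff_mderiv mE mnmBE mnm1E eqxx subn1 prednK // => /eqP.
rewrite -mulr_natr mulf_eq0 mcoeff_eq0 mg /= -(dvdn_pcharf pK) => /(dvdn_leq mi0).
have : (m i <= mdeg m)%N by rewrite mdegE (bigD1 i) //= leq_addr.
lia.
Qed.

Variables (T : finType) (L : T -> K * K * K) (e : rel T).
Hypothesis L_inj : injective L.
Hypothesis e_meet : forall u v, e u v -> (L u).1.1 != (L v).1.1 /\ omega (L u) (L v) = 0.
Hypothesis e_skew : forall u v w, e u v -> e u w -> v != w -> omega (L v) (L w) != 0.

Let Z f := [set v | restrict (L v) f == 0].

Lemma dvd_of_common_line_set g h (S : {set T}) : prime_elt g ->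
  S \subset Z g -> S \subset Z h -> ((msize g).-1 * (msize h).-1 < #|S|)%N -> divides g h.
Proof.
move=> gP Sg Sh ltS; apply: (@dvd_of_common_lines _ _ _ [seq L v | v <- enum S]) => //.
- by rewrite map_inj_uniq ?enum_uniq.
- move=> l /mapP[v]; rewrite mem_enum => vS ->.
  have := subsetP Sg _ vS; have := subsetP Sh _ vS.
  by rewrite !inE => /eqP-> /eqP->.
- by rewrite size_map -cardE.
Qed.

(** Neighbours cross [v] at distinct parameters, all of them roots of [h]. *)
Lemma card_meet_roots v (h : {poly K}) (W : {set T}) : h != 0 ->
  (forall w, w \in W -> e v w /\ root h (meet (L v) (L w))) -> (#|W| < size h)%N.
Proof.
move=> h0 WP; pose rs := [seq meet (L v) (L w) | w <- enum W].
have := max_poly_roots h0 (rs := rs); rewrite size_map -cardE; apply.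
  by apply/allP => x /mapP[w]; rewrite mem_enum => /WP[_ ?] ->.
rewrite map_inj_in_uniq ?enum_uniq // => w w'; rewrite !mem_enum => /WP[vw _] /WP[vw' _].
exact: (meet_inj e_meet e_skew).
Qed.

Lemma card_lines_factorization (s : seq {mpoly K[3]}) :
  (#|Z (\prod_(g <- s) g)| <= \sum_(g <- s) #|Z g|)%N.
Proof.
elim: s => [|g s IHs].
  rewrite !big_nil leqn0 cards_eq0; apply/eqP/setP => v; rewrite !inE.
  by rewrite (rmorph1 (restrict (L v))) oner_eq0.
rewrite !big_cons; apply: leq_trans (leq_add (leqnn _) IHs).
rewrite -cardsUI; apply: leq_trans (leq_addr _ _); apply: subset_leq_card.
by apply/subsetP => v; rewrite !inE restrictM mulf_eq0.
Qed.

Lemma msize_factorization (s : seq {mpoly K[3]}) : (forall g, g \in s -> prime_elt g) ->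
  (msize (\prod_(g <- s) g)).-1 = (\sum_(g <- s) (msize g).-1)%N.
Proof.
elim: s => [|g s IHs] sP; first by rewrite !big_nil msize1.
have [g0 _ _] := sP g (mem_head _ _).
have s0 : \prod_(g <- s) g != 0.
  rewrite prodf_seq_neq0; apply/allP => h hs; have [] // := sP h.
  by rewrite inE hs orbT.
rewrite !big_cons msizeM // -IHs => [|h hs]; last by apply: sP; rewrite inE hs orbT.
by rewrite (mpolySpred _ g0) (mpolySpred _ s0) addnS.
Qed.

(** Pigeonhole over the prime factors: degrees add up, and every line lies on some factor. *)
Lemma rich_prime_factor f c : f != 0 -> (forall v, restrict (L v) f = 0) ->
  (c * (msize f).-1 < #|T|)%N ->
  exists2 g, prime_elt g & divides g f /\ (c * (msize g).-1 < #|Z g|)%N.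
Proof.
move=> f0 Zf ltT; have [s [u uU [sP fE]]] := factorial_mpoly f0.
have u0 : u != 0 by apply: contraTneq uU => ->; rewrite unitr0.
have s0 : \prod_(g <- s) g != 0 by apply: contra_neq f0 => s0; rewrite fE s0 mulr0.
have fs : (msize f).-1 = (\sum_(g <- s) (msize g).-1)%N.
  by rewrite -msize_factorization // fE msizeM // (msize_unit uU).
have Ts : (#|T| <= \sum_(g <- s) #|Z g|)%N.
  apply: leq_trans (card_lines_factorization s); rewrite -cardsT.
  apply: subset_leq_card; apply/subsetP => v _; rewrite inE.
  have := Zf v; rewrite fE restrictM => /eqP; rewrite mulf_eq0 => /orP[/eqP ru|//].
  by have := rmorph_unit (restrict (L v)) uU; rewrite /= ru unitr0.
have [/hasP[g gs lt_g]|/hasPn small] := boolP (has (fun g => c * (msize g).-1 < #|Z g|)%N s).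
  exists g; first exact: sP; split=> //.
  by exists (u * \prod_(h <- rem g s) h); rewrite fE (perm_big _ (perm_to_rem gs)) big_cons /= mulrCA.
have : (#|T| <= c * (msize f).-1)%N.
  apply: leq_trans Ts _; rewrite fs big_distrr /= big_seq [leqRHS]big_seq.
  by apply: leq_sum => g /small; rewrite -leqNgt.
by rewrite leqNgt ltT.
Qed.

Lemma minimal_vanishing d :
  (exists f, [/\ f != 0, (msize f <= d)%N & forall v, restrict (L v) f = 0]) ->
  exists f, [/\ f != 0, (msize f <= d)%N, forall v, restrict (L v) f = 0 &
    forall h, h != 0 -> (forall v, restrict (L v) h = 0) -> (msize f <= msize h)%N].
Proof.
elim/ltn_ind: d => d IHd [f [f0 sf Zf]].
have [min|] := boolp.EM (forall h, h != 0 -> (forall v, restrict (L v) h = 0) ->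
  (msize f <= msize h)%N); first by exists f.
move=> /boolp.existsNP[h] /boolp.not_implyP[h0] /boolp.not_implyP[Zh] /negP.
rewrite -ltnNge => lt_h.
have [|f1 [f10 sf1 Zf1 min]] := IHd (msize h) (leq_trans lt_h sf); first by exists h.
by exists f1; split=> //; apply: leq_trans sf1 (leq_trans (ltnW lt_h) sf).
Qed.

Variables (r d N : nat).
Hypothesis rich : forall v, (r <= #|[set w | e v w]|)%N.
Hypothesis few_k : forall v (W : {set T}), (forall w, w \in W -> e v w) ->
  {in W &, injective (fun w => (L w).1.1)} -> (#|W| <= N)%N.
Hypothesis few_q : forall v (W : {set T}), (forall w, w \in W -> e v w) ->
  {in W &, injective (fun w => (L w).2)} -> (#|W| <= N)%N.
Hypotheses (lt_T : (3 * #|T| < r.+1 * (d + 3))%N) (T_large : (6 * d ^ 2 < #|T|)%N).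
Hypotheses (r_large : (5 * d < r)%N) (N_small : (d + N < r)%N) (p_large : (2 * d < p)%N).

(* The second isotropic direction along a line of the surface is a Moebius
   function of the parameter: if it is not constant, the first coordinates of
   the lines crossing there are distinct, otherwise their third ones are. *)
Lemma no_rich_configuration : False.
Proof.
have [|f [f0 sf Zf fmin]] := @minimal_vanishing d.+1.
  exact: (@vanishing_polynomial _ _ _ _ e_meet e_skew r).
have [|g gP [[f1 fE] ltZ]] := @rich_prime_factor f (6 * d) f0 Zf.
  by apply: leq_ltn_trans T_large; rewrite expnS expn1 mulnA leq_mul2l -subn1 leq_subLR sf orbT.
have [g0 gU gM] := gP.
have f10 : f1 != 0 by apply: contra_neq f0 => f10; rewrite fE f10 mulr0.
have sg1 := msize_nonunit g0 gU.
set m := (msize g).-1 in ltZ; set m1 := (msize f1).-1.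
have sgE : msize g = m.+1 by rewrite /m (mpolySpred _ g0).
have sf1E : msize f1 = m1.+1 by rewrite /m1 (mpolySpred _ f10).
have le_d : (m + m1 <= d)%N by move: sf; rewrite fE msizeM // sgE sf1E addnS.
(* Otherwise [f1], of smaller degree, would vanish on all lines, against the minimality of [f]. *)
have ng1 : ~ divides g f1.
  case=> h hE; have := fmin f1 f10; rewrite fE msizeM // sgE sf1E => /(_ _)/wrap[].
    move=> v; have /eqP := Zf v; rewrite fE restrictM mulf_eq0 => /orP[/eqP gv|/eqP//].
    by rewrite hE restrictM gv mul0r.
  by move: sg1; rewrite sgE; lia.
(* Lines on g = 0 but not on f1 = 0; by Bezout at most [m * m1] are lost. *)
pose S := Z g :\: Z f1.
have cS : (#|Z g| <= #|S| + m * m1)%N.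
  rewrite -(cardsID (Z f1) (Z g)) addnC leq_add2l leqNgt; apply/negP => lt_c; apply: ng1.
  by apply: (dvd_of_common_line_set gP _ _ lt_c); rewrite ?subsetIl ?subsetIr.
(* Neighbours crossing [v] away from f1 = 0: [f] vanishes on them while [f1] does not, so they lie
   on g = 0. *)
pose M v := [set w in [set w | e v w] | ~~ root (restrict (L v) f1) (meet (L v) (L w))].
have M_card v : v \in S -> (r <= #|M v| + m1)%N.
  rewrite !inE => /andP[v1 _].
  apply: leq_trans (rich v) _.
  rewrite -(cardsID [set w | root (restrict (L v) f1) (meet (L v) (L w))]) [leqLHS]addnC.
  apply: leq_add; first by apply: subset_leq_card; apply/subsetP => w; rewrite !inE andbC.
  rewrite -ltnS; apply: leq_trans (leq_trans (size_restrict (L v) f1) _); last by rewrite sf1E.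
  by apply: (@card_meet_roots v) => // w; rewrite !inE => /andP.
have M_g v w : v \in S -> w \in M v -> [/\ e v w, restrict (L v) g = 0 & restrict (L w) g = 0].
  rewrite !inE => /andP[_ /eqP vg] /andP[vw nr]; split=> //.
  have /eqP := Zf w; rewrite fE restrictM mulf_eq0 => /orP[/eqP//|/eqP w1].
  by rewrite (root_restrict_meet e_meet vw w1) in nr.
(* At least [r - m1] crossing points remain on a line of [S], too many roots for a nonzero
   restriction of size at most [r - m1]. *)
have vanish v h (n : nat) : v \in S -> (size (restrict (L v) h) <= n)%N -> (n + m1 <= r)%N ->
    (forall w, w \in M v -> root (restrict (L v) h) (meet (L v) (L w))) ->
    restrict (L v) h = 0.
  move=> vS sh le_r Mr; apply/eqP; apply: contraT => h0.
  have MP w : w \in M v -> e v w /\ root (restrict (L v) h) (meet (L v) (L w)).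
    by move=> wM; split; [have [] := M_g v w vS wM | apply: Mr].
  by have := card_meet_roots h0 MP; have := M_card v vS; lia.
have m_gt0 : (0 < m)%N by move: sg1; rewrite sgE.
have lt_S : (5 * (d * m) < #|S|)%N.
  have : (m * m1 <= m * d)%N by rewrite leq_mul2l; apply/orP; right; lia.
  by move: cS ltZ; rewrite (mulnC m d) -mulnA; lia.
have dm : (m * m <= d * m)%N by rewrite leq_mul2r; apply/orP; right; lia.
have subS (P : {pred T}) h : (forall v, v \in S -> v \in P -> restrict (L v) h = 0) ->
    [set v in S | v \in P] \subset Z g /\ [set v in S | v \in P] \subset Z h.
  move=> PS; split; apply/subsetP => v; rewrite inE => /andP[vS vP].
    by move: vS; rewrite !inE => /andP[].
  by rewrite inE PS.
have dvd_low h : divides g h -> (msize h <= m)%N -> h = 0.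
  move=> dv sh; apply/eqP; apply: contraT => h0.
  by have := divides_msize dv h0; rewrite sgE ltnNge sh.
have sder i : (msize g^`M(i) <= m)%N by rewrite msize_mderiv.
(* If g_0 were zero, [crossing_tangent] would make g_1 and g_2 vanish at the crossing points, hence
   on the lines of [S], hence identically by Bezout and degree. Then [g] would be constant, its
   degree being below [p]. *)
have g'0 : g^`M(i0) != 0.
  apply/eqP => g'0.
  have small i : (forall v w, v \in S -> w \in M v ->
      root (restrict (L v) g^`M(i)) (meet (L v) (L w))) -> g^`M(i) = 0.
    move=> rt; apply: (dvd_low _ _ (sder i)).
    have [|Sg Sh] := subS S g^`M(i).
      move=> v vS _; apply: (vanish v _ m) => //; last by move=> w; apply: rt.
        by rewrite (leq_trans (size_restrict _ _)).
      by lia.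
    apply: (dvd_of_common_line_set gP Sg Sh).
    have -> : [set v in S | v \in S] = S by apply/setP => v; rewrite inE andbb.
    rewrite -/m; apply: leq_ltn_trans lt_S.
    apply: leq_trans (_ : m * m <= _)%N; last by rewrite (leq_trans dm) // leq_pmull.
    by rewrite leq_mul2l (leq_trans (leq_pred _)) ?orbT.
  have : (msize g <= 1)%N.
    apply: deriv_eq0_const; first by rewrite sgE; lia.
    apply: ord3_cases => //.
    + apply: small => v w vS wM; have [vw vg wg] := M_g v w vS wM.
      have [kvw ovw] := e_meet vw; rewrite rootE horner_restrict.
      by have [-> _] := crossing_tangent kvw ovw vg wg; rewrite g'0 meval0 mulr0.
    + apply: small => v w vS wM; have [vw vg wg] := M_g v w vS wM.
      have [kvw ovw] := e_meet vw; rewrite rootE horner_restrict.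
      by have [_ ->] := crossing_tangent kvw ovw vg wg; rewrite g'0 meval0 mulr0.
  by rewrite leqNgt sg1.
pose S2 := [set v in S | restrict (L v) g^`M(i0) != 0].
have lt_S2 : (4 * (d * m) < #|S2|)%N.
  suff : (#|S| <= #|S2| + m * m)%N by lia.
  rewrite -(cardsID (Z g^`M(i0)) S) [leqLHS]addnC; apply: leq_add.
    by apply: subset_leq_card; apply/subsetP => v; rewrite !inE andbC.
  rewrite leqNgt; apply/negP => lt_c; case/eqP: g'0; apply: (dvd_low _ _ (sder i0)).
  apply: (dvd_of_common_line_set gP _ _ (leq_ltn_trans _ lt_c)); rewrite ?subsetIr //.
    by apply/subsetP => v; rewrite !inE => /andP[/andP[]].
  by rewrite leq_mul2l (leq_trans (leq_pred _)) ?orbT.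
have [sfl1 sfl2] := msize_flat (eq_leq sgE).
(* [5 * d < r] leaves room for restrictions of degree [4 * m], and [4 * (d * m) < #|S2|] for
   Bezout. *)
have flat_div h : (msize h <= (4 * m).+1)%N ->
    (forall v w, v \in S -> w \in M v -> h.@[line_point (L v) (meet (L v) (L w))] = 0) ->
    divides g h.
  move=> sh h0; have [|Sg Sh] := subS [pred v | restrict (L v) g^`M(i0) != 0] h.
    move=> v vS _; apply: (vanish v _ (4 * m).+1) => //.
    - by rewrite (leq_trans (size_restrict _ _)).
    - by lia.
    - by move=> w wM; rewrite rootE horner_restrict h0.
  apply: (dvd_of_common_line_set gP Sg Sh); apply: leq_ltn_trans lt_S2; rewrite -/m.
  apply: leq_trans (_ : m * (4 * m) <= _)%N; first by rewrite leq_mul2l -subn1 leq_subLR sh orbT.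
  by rewrite mulnCA leq_mul2l dm orbT.
have [d1 d2] : divides g (flat1 g) /\ divides g (flat2 g).
  by split; apply: flat_div => // v w vS wM; have [vw vg wg] := M_g v w vS wM;
    have [kvw ovw] := e_meet vw; have [] := crossing_flat kvw ovw vg wg.
have [v] : exists v, v \in S2 by apply/card_gt0P; apply: leq_ltn_trans lt_S2.
rewrite inE => /andP[vS A0]; set A := restrict _ _ in A0.
(* At these crossings g_0 is nonzero, so b / A is the difference k' - k of the directions. *)
pose M2 := [set w in M v | ~~ root A (meet (L v) (L w))].
have cM2 : (N < #|M2|)%N.
  suff : (#|M v| <= #|M2| + m)%N by have := M_card v vS; lia.
  rewrite -(cardsID [set w | root A (meet (L v) (L w))] (M v)) [leqLHS]addnC; apply: leq_add.
    by apply: subset_leq_card; apply/subsetP => w; rewrite !inE andbC.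
  rewrite ltnW //; apply: leq_trans (leq_trans (size_restrict (L v) g^`M(i0)) (sder i0)).
  apply: (@card_meet_roots v) => // w; rewrite inE => /andP[wM]; rewrite inE => rw.
  by have [] := M_g v w vS wM.
pose b := restrict (L v) g^`M(i1) - 2%:R * (L v).1.1%:P * A.
have M2P w : w \in M2 -> [/\ e v w, A.[meet (L v) (L w)] != 0 &
    b.[meet (L v) (L w)] = A.[meet (L v) (L w)] * ((L w).1.1 - (L v).1.1)].
  rewrite inE => /andP[wM rA]; have [vw vg wg] := M_g v w vS wM; split=> //.
  have [kvw ovw] := e_meet vw; have [e1 _] := crossing_tangent kvw ovw vg wg.
  rewrite /b -polyC_natr !hornerE horner_restrict e1 -horner_restrict -/A.
  by ring.
have b0 : b != 0.
  have [w /M2P[vw Aw bw]] : exists w, w \in M2 by apply/card_gt0P; apply: leq_ltn_trans cM2.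
  apply: contra_neq Aw => b0; move/eqP: bw; rewrite b0 horner0 eq_sym mulf_eq0 subr_eq0.
  by have [/negPf kvw _] := e_meet vw; rewrite [(L w).1.1 == _]eq_sym kvw orbF => /eqP.
have vg : restrict (L v) g = 0 by move: vS; rewrite !inE => /andP[_ /eqP].
have [x [y Ab]] : exists x y, A = (x%:P + y *: 'X) * b.
  by apply: (flat_line_fraction vg d1 d2 pK) => //; rewrite sgE; lia.
(* 1 / (k' - k) equals x + y s at the crossing parameter s, which makes k' a Moebius function of
   s. *)
have M2_eq w : w \in M2 ->
    (x + y * meet (L v) (L w)) * ((L w).1.1 - (L v).1.1) = 1.
  move=> /M2P[vw Aw bw]; apply: (mulIf Aw); rewrite mul1r [in RHS]Ab hornerM bw hornerD hornerC hornerZ hornerX.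
  by ring.
have M2_e w : w \in M2 -> e v w by case/M2P.
have minj := meet_inj e_meet e_skew.
have [y0|y0] := eqVneq y 0.
  have : (#|M2| <= N)%N.
    apply: (few_q M2_e) => w w' wM wM' /= qq.
    apply: (minj v); [exact: M2_e|exact: M2_e|rewrite /= /meet qq; congr (_ / _)].
    have := M2_eq w wM; rewrite y0 mul0r addr0 => h; have := M2_eq w' wM'.
    rewrite y0 mul0r addr0 -h => /(mulfI _) h'.
    have x0 : x != 0 by apply: contraTneq (oner_neq0 K) => x0; rewrite -h x0 mul0r eqxx.
    by have := h' x0 => /addIr ->.
  by rewrite leqNgt cM2.
have : (#|M2| <= N)%N.
  apply: (few_k M2_e) => w w' wM wM' /= kk.
  apply: (minj v); [exact: M2_e|exact: M2_e|move=> /=].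
  have h := M2_eq w wM; have := M2_eq w' wM'; rewrite -h -kk => /mulIf h'.
  have k0 : (L w).1.1 - (L v).1.1 != 0.
    by apply: contraTneq (oner_neq0 K) => k0; rewrite -h k0 mulr0 eqxx.
  by have := h' k0 => /addrI/(mulfI y0).
by rewrite leqNgt cM2.
Qed.
End RichConfiguration.

(** * Collinear triples as intersecting lines *)

(** Vertices of degree at most [r] are deleted one by one. Each deletion loses at most [2 * r]
    ordered pairs, so the density hypothesis persists and the process stops at a nonempty set. *)
Lemma min_degree_subgraph (T : finType) (e : rel T) (r : nat) : symmetric e ->
  (2 * r * #|T| < #|[set x : T * T | e x.1 x.2]|)%N ->
  exists V : {set T}, (exists v, v \in V) /\
    forall v, v \in V -> (r < #|[set w in V | e v w]|)%N.
Proof.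
move=> es.
pose E (V : {set T}) := [set x : T * T | [&& x.1 \in V, x.2 \in V & e x.1 x.2]].
suff main n (V : {set T}) : #|V| = n -> (2 * r * n < #|E V|)%N ->
  exists V' : {set T}, (exists v, v \in V') /\
    forall v, v \in V' -> (r < #|[set w in V' | e v w]|)%N.
  move=> lt_E; apply: (main #|T| setT); rewrite ?cardsT //.
  by rewrite (_ : E _ = [set x : T * T | e x.1 x.2]) //; apply/setP => x; rewrite !inE.
elim: n V => [|n IHn] V cV lt_E.
  have V0 : V = set0 by apply/eqP; rewrite -cards_eq0 cV.
  move: lt_E; rewrite muln0 => /card_gt0P[x]; rewrite inE V0 inE.
  by [].
have [/forallP deg|] := boolP [forall v, (v \in V) ==> (r < #|[set w in V | e v w]|)%N].
  exists V; split; last by move=> v; apply/implyP.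
  by apply/card_gt0P; rewrite cV.
rewrite negb_forall => /existsP[v]; rewrite negb_imply -leqNgt => /andP[vV dv].
apply: (IHn (V :\ v)).
  by apply/eqP; move: cV; rewrite (cardsD1 v) vV add1n => -[->].
set D := [set w in V | e v w] in dv.
have : (#|E V| <= #|E (V :\ v)| + #|[set (v, w) | w in D]| + #|[set (w, v) | w in D]|)%N.
  apply: leq_trans (_ : #|E (V :\ v) :|: [set (v, w) | w in D] :|: [set (w, v) | w in D]| <= _)%N.
    apply: subset_leq_card; apply/subsetP => -[x y]; rewrite !inE /= => /and3P[xV yV exy].
    rewrite xV yV exy !andbT.
    have [xv|xv] := eqVneq x v.
      apply/orP; left; apply/orP; right; apply/imsetP; exists y; rewrite ?xv //.
      by rewrite inE yV -xv.
    have [yv|//] := eqVneq y v.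
    apply/orP; right; apply/imsetP; exists x; rewrite ?yv //.
    by rewrite inE xV es -yv.
  apply: leq_trans (leq_card_setU _ _).1 _; rewrite leq_add2r.
  exact: (leq_card_setU _ _).1.
have c1 : (#|[set (v, w) | w in D]| <= r)%N := leq_trans (leq_imset_card _ _) dv.
have c2 : (#|[set (w, v) | w in D]| <= r)%N := leq_trans (leq_imset_card _ _) dv.
move: lt_E c1 c2; rewrite mulnS.
by move: #|_| #|_| #|_| #|_| => c4 c3 c2' c1' *; lia.
Qed.

(** From r^2 >= 100 v follow 33 d <= r and 100 d^2 <= 9 v, while 14 N <= r since 196 < 200. Finally
    4 d^2 < N^3 < p^2, where the size of the grid is weighed against the characteristic. *)
Lemma rich_arith (v r d N p : nat) : (0 < v -> v <= 2 * N ^ 3 -> N ^ 3 < p ^ 2 ->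
  200 * N ^ 3 <= r ^ 2 -> d * r.+1 <= 3 * v ->
  [/\ 6 * d ^ 2 < v, 5 * d < r, d + N < r & 2 * d < p])%N.
Proof.
move=> v0 le_v lt_p le_r le_d.
have sq x : (x ^ 2 = x * x)%N by rewrite expnS expn1.
have le_vr : (100 * v <= r * r)%N by rewrite -sq; lia.
have r0 : (0 < r)%N by case: (r) le_vr => //; lia.
have le_dr : (d * r <= 3 * v)%N by apply: leq_trans le_d; rewrite leq_mul2l leqnSn orbT.
have h33 : (33 * d <= r)%N.
  rewrite -(leq_pmul2r r0); apply: leq_trans le_vr; rewrite -mulnA; lia.
have hd : (100 * (d * d) <= 9 * v)%N.
  have r2 : (0 < r * r)%N by rewrite muln_gt0 r0.
  rewrite -(leq_pmul2r r2).
  have h1 : (d * r * (d * r) <= 3 * v * (3 * v))%N by apply: leq_mul.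
  have h2 : (9 * v * (100 * v) <= 9 * v * (r * r))%N by rewrite leq_mul2l le_vr orbT.
  move: h1 h2; nia.
have N0 : (0 < N)%N by rewrite lt0n; apply: contraTneq v0 => N0; move: le_v; rewrite N0; lia.
have hN : (14 * N <= r)%N.
  rewrite -(leq_exp2r _ _ (isT : 0 < 2)%N); apply: leq_trans le_r.
  have : (N ^ 2 <= N ^ 3)%N by rewrite leq_pexp2l.
  by rewrite expnMn; lia.
rewrite sq; split; [lia|lia|lia|].
by rewrite -(ltn_exp2r _ _ (isT : 0 < 2)%N) expnMn (sq d); lia.
Qed.

(** * The incidence bound between triples *)

Section Incidences.
Variables (F : fieldType) (p : nat).
Hypothesis pF : p \in [pchar F].
Variables (T : finType) (a : T -> F).
Hypothesis a_inj : injective a.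

Local Notation triple := (T * T * T)%type.

(** For x = (a1, a2, b) and y = (b1, b2, c) the equation says that (a1, b1), (a2, b2), (c, b) are
    collinear. The third coordinates are exchanged to make it bilinear in data of [x] and data of
    [y]. *)
Definition incident (x y : triple) :=
  [&& x.1.1 != x.1.2, y.1.1 != y.1.2 &
    a x.2 * (a x.1.1 - a x.1.2) + a y.2 * (a y.1.2 - a y.1.1)
    + a x.1.2 * a y.1.1 - a x.1.1 * a y.1.2 == 0].

Local Notation FX := {fraction {poly F}}.

(* The transcendental 'X makes lines of the same family pairwise skew, whatever
   the field F, while leaving the incidence relation between the families
   unchanged. *)
Definition poly_line (v : triple + triple) : {poly F} * {poly F} * {poly F} :=
  match v with
  | inl (a1, a2, b) => ((a a2)%:P,
      - (a b * (a a1 - a a2))%:P + (a a1)%:P * 'X + (a a2)%:P * 'X ^+ 2, (a a1)%:P)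
  | inr (b1, b2, c) => ((a b2)%:P - 'X, (a c * (a b2 - a b1))%:P, (a b1)%:P + 'X ^+ 2)
  end.

Definition frac_line v : FX * FX * FX :=
  let l := poly_line v in (tofrac l.1.1, tofrac l.1.2, tofrac l.2).

Definition adjacent : rel (triple + triple) := fun v w =>
  match v, w with
  | inl x, inr y => incident x y
  | inr y, inl x => incident x y
  | _, _ => false
  end.

Definition poly_omega (l l' : {poly F} * {poly F} * {poly F}) :=
  l'.1.2 - l.1.2 + l.1.1 * l'.2 - l'.1.1 * l.2.

Lemma omega_frac v w :
  omega (frac_line v) (frac_line w) = tofrac (poly_omega (poly_line v) (poly_line w)).
Proof. by rewrite /omega /poly_omega /frac_line /= !(tofracD, tofracN, tofracM). Qed.

Lemma poly_omega_incident x y : incident x y ->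
  poly_omega (poly_line (inl x)) (poly_line (inr y)) = 0.
Proof.
case: x y => [[a1 a2] b] [[b1 b2] c] /and3P[_ _ /= /eqP eq0].
rewrite /poly_omega /= -[RHS](rmorph0 (@polyC F)) -eq0.
by rewrite !(polyCD, polyCM, polyCN); ring.
Qed.

Lemma quadratic_eq0 (x y z : F) : x%:P + y%:P * 'X + z%:P * 'X ^+ 2 = 0 ->
  [/\ x = 0, y = 0 & z = 0].
Proof.
move=> /polyP h; have := h 0%N; have := h 1%N; have := h 2%N.
rewrite !coefD !coefCM !coefC !coefX !coefXn /= !mulr0 !mulr1 !addr0 !add0r.
by move=> -> -> ->.
Qed.

Definition nondegenerate (v : triple + triple) :=
  match v with inl x | inr x => x.1.1 != x.1.2 end.

Definition same_side (v w : triple + triple) :=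
  match v, w with inl _, inl _ | inr _, inr _ => true | _, _ => false end.

(** The coefficients of ['X] and ['X ^+ 2] are differences of the first two entries. If these
    vanish, the constant term is, up to sign, the difference of the third entries times a factor
    that nondegeneracy makes nonzero. *)
Lemma poly_omega_skew v w : same_side v w -> nondegenerate v -> nondegenerate w ->
  v != w -> poly_omega (poly_line v) (poly_line w) != 0.
Proof.
have aE x y : (a x == a y) = (x == y) by apply: inj_eq.
case: v w => [[[a1 a2] b]|[[b1 b2] c]] [[[a1' a2'] b']|[[b1' b2'] c']] //= _ nd _.
  apply: contra_neq => om; have := om.
  rewrite /poly_omega /= (_ : _ - _ =
    (- (a b' * (a a1' - a a2')) + a b * (a a1 - a a2) + a a2 * a a1' - a a2' * a a1)%:P
    + (a a1' - a a1)%:P * 'X + (a a2' - a a2)%:P * 'X ^+ 2); last first.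
    by rewrite !(polyCD, polyCM, polyCN); ring.
  case/quadratic_eq0 => e0 /eqP; rewrite subr_eq0 aE => /eqP e1 /eqP.
  rewrite subr_eq0 aE => /eqP e2; move: e0; rewrite e1 e2 => e0.
  have /eqP : (a b - a b') * (a a1 - a a2) = 0 by rewrite -[RHS]e0; ring.
  rewrite mulf_eq0 !subr_eq0 !aE => /orP[/eqP->//|e3].
  by rewrite e3 in nd.
apply: contra_neq => om; have := om.
rewrite /poly_omega /= (_ : _ - _ =
    (a c' * (a b2' - a b1') - a c * (a b2 - a b1) + a b2 * a b1' - a b2' * a b1)%:P
    + (a b1 - a b1')%:P * 'X + (a b2 - a b2')%:P * 'X ^+ 2); last first.
  by rewrite !(polyCD, polyCM, polyCN); ring.
case/quadratic_eq0 => e0 /eqP; rewrite subr_eq0 aE => /eqP e1 /eqP.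
rewrite subr_eq0 aE => /eqP e2; move: e0; rewrite e1 e2 => e0.
have /eqP : (a c' - a c) * (a b2' - a b1') = 0 by rewrite -[RHS]e0; ring.
rewrite mulf_eq0 !subr_eq0 !aE => /orP[/eqP->//|e3].
by rewrite e1 e2 eq_sym e3 in nd.
Qed.

Lemma poly_omega_antisym l l' : poly_omega l' l = - poly_omega l l'.
Proof. by rewrite /poly_omega; ring. Qed.

Lemma adjacent_sym : symmetric adjacent.
Proof. by case=> x [y|y]. Qed.

Lemma adjacent_side u v w : adjacent u v -> adjacent u w -> same_side v w.
Proof. by case: u v w => [?|?] [?|?] [?|?]. Qed.

Lemma adjacent_nondegenerate v w : adjacent v w -> nondegenerate v.
Proof. by case: v w => [x|x] [y|y] //= /and3P[]. Qed.

(** The directions differ because exactly one of them involves ['X]. *)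
Lemma adjacent_meet v w : adjacent v w ->
  (frac_line v).1.1 != (frac_line w).1.1 /\ omega (frac_line v) (frac_line w) = 0.
Proof.
have dirX b c : b%:P != c%:P - 'X :> {poly F}.
  apply/eqP => /polyP/(_ 1%N)/eqP; rewrite coefB !coefC coefX /= sub0r eq_sym oppr_eq0.
  by rewrite oner_eq0.
rewrite omega_frac /frac_line /= tofrac_eq.
case: v w => [x|y] [x'|y'] //= inc.
  split; last by rewrite poly_omega_incident ?tofrac0.
  by case: x y' {inc} => [[? ?] ?] [[? ?] ?]; apply: dirX.
split; last by rewrite poly_omega_antisym poly_omega_incident // oppr0 tofrac0.
by case: x' y {inc} => [[? ?] ?] [[? ?] ?]; rewrite eq_sym; apply: dirX.
Qed.

Lemma frac_line_inj v w : nondegenerate v -> nondegenerate w ->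
  frac_line v = frac_line w -> v = w.
Proof.
move=> ndv ndw [/eqP]; rewrite tofrac_eq => /eqP e1 /eqP; rewrite tofrac_eq => /eqP e2.
move=> /eqP; rewrite tofrac_eq => /eqP e3.
have [side|nside] := boolP (same_side v w).
  apply/eqP; apply: contraT => /(poly_omega_skew side ndv ndw).
  by rewrite /poly_omega e1 e2 e3 !subrr add0r subrr eqxx.
case: v w e1 {e2 e3 ndv ndw} nside => [[[? ?] ?]|[[? ?] ?]] [[[? ?] ?]|[[? ?] ?]] //= /polyP/(_ 1%N)/eqP;
  rewrite coefB !coefC coefX /= sub0r ?[0 == _]eq_sym oppr_eq0 oner_eq0 //.
Qed.

Lemma incidence_bound (r : nat) : (#|T| ^ 3 < p ^ 2)%N -> (200 * #|T| ^ 3 <= r ^ 2)%N ->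
  (#|[set x : triple * triple | incident x.1 x.2]| <= 2 * r * #|T| ^ 3)%N.
Proof.
move=> lt_p le_r; rewrite leqNgt; apply/negP => lt_I.
have cV : #|{: triple + triple}| = (2 * #|T| ^ 3)%N.
  by rewrite card_sum !card_prod; lia.
(* The symmetric relation counts each incidence twice, on [2 * #|T| ^ 3] vertices. *)
have [|V [[v0 v0V] VP]] := @min_degree_subgraph _ adjacent r adjacent_sym.
  rewrite cV; set I := [set x | _] in lt_I.
  pose f1 (x : triple * triple) : (triple + triple) * (triple + triple) := (inl x.1, inr x.2).
  pose f2 (x : triple * triple) : (triple + triple) * (triple + triple) := (inr x.2, inl x.1).
  have f1I : injective f1 by move=> [x y] [x' y'] [-> ->].
  have f2I : injective f2 by move=> [x y] [x' y'] [-> ->].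
  have : (#|f1 @: I :|: f2 @: I| <= #|[set x | adjacent x.1 x.2]|)%N.
    apply: subset_leq_card; apply/subsetP => x; rewrite !inE.
    by case/orP=> /imsetP[y]; rewrite inE => yI ->.
  rewrite cardsU (card_imset _ f1I) (card_imset _ f2I).
  rewrite (_ : f1 @: I :&: f2 @: I = set0) ?cards0.
    rewrite subn0 mulnCA addnn -mul2n => h; apply: leq_trans h.
    by rewrite ltn_pmul2l.
  apply/setP => x; rewrite !inE; apply/negP => /andP[/imsetP[y _ ->] /imsetP[z _]].
  by [].
pose U : finType := {v | v \in V}.
pose eU : rel U := fun v w => adjacent (val v) (val w).
pose LU (v : U) := frac_line (val v).
have degU (v : U) : (r < #|[set w | eU v w]|)%N.
  apply: leq_trans (VP _ (valP v)) _.
  rewrite -(card_imset _ val_inj) /=; apply: subset_leq_card; apply/subsetP => w.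
  rewrite inE => /andP[wV vw]; apply/imsetP; exists (Sub w wV); rewrite ?SubK //.
  by rewrite inE /eU SubK.
have ndU (v : U) : nondegenerate (val v).
  have /card_gt0P[w] : (0 < #|[set w | eU v w]|)%N by apply: leq_ltn_trans (degU v).
  by rewrite inE => /adjacent_nondegenerate.
have pFX : p \in [pchar FX].
  by apply: (rmorph_pchar (@tofrac _)); apply: (rmorph_pchar (@polyC F)).
(* Up to an additive constant, the least degree that [vanishing_polynomial] allows. *)
pose v := #|U|; pose d := (3 * v %/ r.+1)%N.
have v_gt0 : (0 < v)%N by apply/card_gt0P; exists (Sub v0 v0V).
have le_v : (v <= 2 * #|T| ^ 3)%N by rewrite -cV /v card_sub; apply: max_card.
have [a1 a2 a3 a4] := rich_arith v_gt0 le_v lt_p le_r (leq_trunc_div _ _).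
(* All neighbours of a line lie on one side, where the first and the third line parameters each
   depend on a single entry in [T]. *)
have few (W : {set U}) (g : triple -> T) :
    {in W &, forall w w', g (match val w with inl x | inr x => x end)
                        = g (match val w' with inl x | inr x => x end) -> w = w'} ->
    (#|W| <= #|T|)%N.
  move=> gI; rewrite -(card_in_imset (f := fun w : U => g (match val w with inl x | inr x => x end))).
    exact: max_card.
  by move=> w w' wW w'W; apply: gI.
apply: (@no_rich_configuration FX p pFX U LU eU _ _ _ r d #|T|) => //.
- by move=> x y /frac_line_inj h; apply: val_inj; apply: h.
- by move=> x y; apply: adjacent_meet.
- move=> x y z xy xz nyz; rewrite omega_frac tofrac_eq0.
  by apply: poly_omega_skew; rewrite ?ndU //; apply: adjacent_side xy xz.
- by move=> u; apply: ltnW.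
- move=> u W uW kI; apply: (few W (fun x => x.1.2)) => w w' wW w'W ew.
  apply: kI => //; move: ew (adjacent_side (uW _ wW) (uW _ w'W)).
  rewrite /LU /frac_line /=.
  by case: (val w) (val w') => [[[? ?] ?]|[[? ?] ?]] [[[? ?] ?]|[[? ?] ?]] //= ->.
- move=> u W uW kI; apply: (few W (fun x => x.1.1)) => w w' wW w'W ew.
  apply: kI => //; move: ew (adjacent_side (uW _ wW) (uW _ w'W)).
  rewrite /LU /frac_line /=.
  by case: (val w) (val w') => [[[? ?] ?]|[[? ?] ?]] [[[? ?] ?]|[[? ?] ?]] //= ->.
have := ltn_ceil (3 * v) (ltn0Sn r); rewrite -/d => lt_d.
apply: leq_trans lt_d _; rewrite mulnC leq_mul2l; apply/orP; right; lia.
Qed.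
End Incidences.

(** * Cartesian products *)

Lemma Cauchy_Schwarz_nat (I : Type) (s : seq I) (x y : I -> nat) :
  ((\sum_(i <- s) x i * y i) ^ 2
     <= (\sum_(i <- s) x i ^ 2) * (\sum_(i <- s) y i ^ 2))%N.
Proof.
rewrite -(leq_pmul2l (isT : 0 < 2)%N) expnS expn1 !big_distrlr /= mul2n -addnn.
rewrite [leqRHS]mul2n -addnn [X in (_ <= _ + X)%N]exchange_big /= -!big_split /=.
apply: leq_sum => i _; rewrite -!big_split /=; apply: leq_sum => j _.
have := (nat_Cauchy (x i * y j) (x j * y i)).1; rewrite !expnMn.
by rewrite mul2n -addnn mulnACA [(y j * _)%N]mulnC -mulnACA.
Qed.

Lemma card_fiber_product_Cauchy (X Y : finType) (V : eqType) (f : X -> V) (g : Y -> V) :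
  (#|[set z : X * Y | f z.1 == g z.2]| ^ 2
    <= #|[set z : X * X | f z.1 == f z.2]| * #|[set z : Y * Y | g z.1 == g z.2]|)%N.
Proof.
pose vs := undup (codom f); pose be v := #|[set y | g y == v]|.
have sumE (Z : finType) (h : Z -> V) (c : V -> nat) :
    (\sum_(v <- vs) #|[set z | h z == v]| * c v = \sum_(z | h z \in vs) c (h z))%N.
  transitivity (\sum_(v <- vs) \sum_(z | h z == v) c v)%N.
    by apply: eq_bigr => v _; rewrite -sum_nat_const; apply: eq_bigl => z; rewrite inE.
  rewrite (exchange_big_dep (fun z => true)) //= [RHS]big_mkcond; apply: eq_bigr => z _.
  case: ifP => hz; last first.
    rewrite big_seq_cond big1 // => v /andP[vvs /eqP hv].
    by rewrite -hv hz in vvs.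
  rewrite big_mkcond (bigD1_seq (h z)) ?undup_uniq //= eqxx big1 ?addn0 // => v /negPf nv.
  by rewrite eq_sym nv.
have cardE (Z W : finType) (h : Z -> V) (k : W -> V) :
    #|[set z : Z * W | h z.1 == k z.2]| = (\sum_z #|[set w | k w == h z]|)%N.
  rewrite -sum1_card (eq_bigl (fun z : Z * W => true && (h z.1 == k z.2))); last first.
    by move=> z; rewrite inE.
  rewrite -(pair_big_dep xpredT (fun z w => h z == k w) (fun _ _ => 1%N)) /=.
  by apply: eq_bigr => z _; rewrite sum1_card -cardsE; apply: eq_card => w; rewrite !inE eq_sym.
have fv x : f x \in vs by rewrite mem_undup codom_f.
have fE c : (\sum_(z | f z \in vs) c (f z) = \sum_z c (f z))%N.
  by apply: eq_bigl => z; rewrite fv.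
pose al v := #|[set x | f x == v]|.
have -> : #|[set z : X * Y | f z.1 == g z.2]| = (\sum_(v <- vs) al v * be v)%N.
  by rewrite cardE (sumE _ f be) fE.
have -> : #|[set z : X * X | f z.1 == f z.2]| = (\sum_(v <- vs) al v * al v)%N.
  by rewrite cardE (sumE _ f al) fE.
have le_g : (\sum_(v <- vs) be v * be v <= #|[set z : Y * Y | g z.1 == g z.2]|)%N.
  by rewrite cardE (sumE _ g be) big_mkcond; apply: leq_sum => z _; case: ifP.
apply: leq_trans (Cauchy_Schwarz_nat _ _ _) _; apply: leq_mul.
  by apply: leq_sum => v _; rewrite expnS expn1.
by apply: leq_trans le_g; apply: leq_sum => v _; rewrite expnS expn1.
Qed.

(** * Collinear triples in a grid *)

Section GridTriples.
Variables (F : fieldType) (S T : finType) (a : S -> F) (b : T -> F).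
Implicit Types (x : S * S * S) (y : T * T * T).

Definition on_line x y :=
  (a x.2 - a x.1.1) * (b y.1.2 - b y.1.1) == (b y.2 - b y.1.1) * (a x.1.2 - a x.1.1).

(** The first two points differ in both coordinates, so that for injective [a] and [b] both
    denominators of the common ratio are nonzero. *)
Definition generic_triples : {set (S * S * S) * (T * T * T)} :=
  [set z | [&& z.1.1.1 != z.1.1.2, z.2.1.1 != z.2.1.2 & on_line z.1 z.2]].

End GridTriples.

Section GridTriplesBound.
Variables (F : fieldType) (p : nat).
Hypothesis pF : p \in [pchar F].

(* A triple lies on an oblique line iff its two coordinate triples have the
   same ratio, so the count is a sum over ratios of products. *)
Lemma generic_triples_Cauchy (S T : finType) (a : S -> F) (b : T -> F) :
  injective a -> injective b ->
  (#|generic_triples a b| ^ 2 <= #|generic_triples a a| * #|generic_triples b b|)%N.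
Proof.
move=> aI bI.
pose ratio (U : finType) (c : U -> F) (u : {u : U * U * U | u.1.1 != u.1.2}) :=
  (c (val u).2 - c (val u).1.1) / (c (val u).1.2 - c (val u).1.1).
have nz (U : finType) (c : U -> F) (u : U * U * U) : injective c ->
    u.1.1 != u.1.2 -> c u.1.2 - c u.1.1 != 0.
  by move=> cI; rewrite subr_eq0 (inj_eq cI) eq_sym.
have E (U W : finType) (c : U -> F) (d : W -> F) : injective c -> injective d ->
    #|generic_triples c d| = #|[set z | ratio U c z.1 == ratio W d z.2]|.
  move=> cI dI; pose g (z : {u : U * U * U | u.1.1 != u.1.2} * {u : W * W * W | u.1.1 != u.1.2}) :=
    (val z.1, val z.2).
  have gI : injective g by move=> [u w] [u' w'] [/val_inj-> /val_inj->].
  rewrite -(card_imset _ gI); apply: eq_card => -[u w]; rewrite inE /=.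
  apply/and3P/imsetP => [[nu nw ol]|[[u' w']]].
    exists (Sub u nu, Sub w nw); rewrite /g ?SubK // inE /ratio !SubK.
    by rewrite eqr_div ?nz.
  rewrite inE /g /= => r [-> ->]; split; [exact: (valP u')|exact: (valP w')|].
  by move: r; rewrite /ratio eqr_div ?nz ?(valP u') ?(valP w').
by rewrite !E //; apply: card_fiber_product_Cauchy.
Qed.

Lemma generic_triples_incident (S : finType) (a : S -> F) :
  #|generic_triples a a| = #|[set x | incident a x.1 x.2]|.
Proof.
pose g (z : (S * S * S) * (S * S * S)) := ((z.1.1, z.2.2), (z.2.1, z.1.2)).
have gK : involutive g by case=> [[[? ?] ?] [[? ?] ?]].
rewrite -(card_imset _ (inv_inj gK)); apply: eq_card => z.
rewrite -[z]gK (mem_imset _ _ (inv_inj gK)); move: {z}(g z) => [[[x1 x2] x3] [[y1 y2] y3]].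
rewrite !inE /incident /on_line /=; congr [&& _, _ & _].
rewrite -subr_eq0; congr (_ == 0); ring.
Qed.

(** The least [r] meeting the lower bound satisfies r <= 2 (r - 1), whence the factor 4. *)
Lemma square_root_between n : (0 < n)%N -> exists r, (200 * n <= r ^ 2 <= 800 * n)%N.
Proof.
move=> n0; pose P r := (200 * n <= r ^ 2)%N.
have exP : exists r, P r by exists (200 * n)%N; rewrite /P expnS expn1 leq_pmulr // muln_gt0.
case: (ex_minnP exP) => r rP rmin; exists r; apply/andP; split; first exact: rP.
case: r rP rmin => [|r] rP rmin; first by rewrite exp0n.
have : ~~ P r by apply/negP => /rmin; rewrite ltnn.
rewrite /P -ltnNge => lt_r; have r0 : (0 < r)%N.
  by case: r rP {rmin lt_r} => //; rewrite /P expnS expn1; lia.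
have : (r.+1 * r.+1 <= (2 * r) * (2 * r))%N by apply: leq_mul; lia.
by move: lt_r; rewrite !expnS !expn0 !muln1; lia.
Qed.

(** 3200 is 2^2 times 800, from the square of [2 * r * #|S| ^ 3]. *)
Lemma generic_triples_diag (S : finType) (a : S -> F) : injective a ->
  (0 < #|S|)%N -> (#|S| ^ 3 < p ^ 2)%N -> (#|generic_triples a a| ^ 2 <= 3200 * #|S| ^ 9)%N.
Proof.
move=> aI S0 lt_p; have S3 : (0 < #|S| ^ 3)%N by rewrite expn_gt0 S0.
have [r /andP[le_r r_le]] := square_root_between S3.
rewrite generic_triples_incident.
apply: leq_trans (_ : (2 * r * #|S| ^ 3) ^ 2 <= _)%N.
  by rewrite leq_exp2r // (incidence_bound pF aI lt_p le_r).
have -> : (#|S| ^ 9 = #|S| ^ 3 * (#|S| ^ 3) ^ 2)%N by rewrite -expnM -expnD.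
rewrite [leqLHS]expnMn [leqRHS]mulnA leq_mul2r expnMn.
by apply/orP; right; move: r_le; lia.
Qed.

(** 57 is the least integer whose fourth power reaches 3200^2. *)
Lemma generic_triples_bound (S T : finType) (a : S -> F) (b : T -> F) :
  injective a -> injective b -> (0 < #|S|)%N -> (0 < #|T|)%N ->
  (#|S| ^ 3 < p ^ 2)%N -> (#|T| ^ 3 < p ^ 2)%N ->
  (#|generic_triples a b| ^ 4 <= (57 ^ 4) * (#|S| * #|T|) ^ 9)%N.
Proof.
move=> aI bI S0 T0 Sp Tp.
rewrite (_ : 4 = 2 * 2)%N // [leqLHS]expnM.
apply: leq_trans (_ : (#|generic_triples a a| * #|generic_triples b b|) ^ 2 <= _)%N.
  by rewrite leq_exp2r // generic_triples_Cauchy.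
rewrite expnMn; apply: leq_trans (leq_mul (generic_triples_diag aI S0 Sp) (generic_triples_diag bI T0 Tp)) _.
rewrite mulnACA -expnMn leq_mul2r; apply/orP; right; lia.
Qed.
End GridTriplesBound.

(** * Lines and real exponents *)

(* Imported only now: the notations clash with those of [mpoly]. *)
Import finmap boolp classical_sets reals exp.

Local Open Scope ring_scope.

Section Lines.
Variable F : fieldType.
Implicit Types (l : set (F * F)) (q : F * F).

Lemma line_direction l q1 q2 : is_line l -> l q1 -> l q2 ->
  exists al be : F, [/\ (al, be) != (0, 0),
    al * (q2.1 - q1.1) + be * (q2.2 - q1.2) = 0 &
    forall q, l q <-> al * (q.1 - q1.1) + be * (q.2 - q1.2) = 0].
Proof.
case=> al [be [c [ab0 ->]]] /= e1 e2; exists al, be; split=> //.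
  by transitivity (al * q2.1 + be * q2.2 - (al * q1.1 + be * q1.2)); [ring|rewrite e1 e2 subrr].
move=> q; rewrite [X in _ <-> X = 0](_ : _ = al * q.1 + be * q.2 - (al * q1.1 + be * q1.2)); last by ring.
by rewrite /= e1; split=> [->|/eqP]; rewrite ?subrr // subr_eq0 => /eqP.
Qed.

(** Both difference vectors are killed by the linear form (al, be), so al and be, not both zero,
    annihilate their determinant. *)
Lemma line_det l q1 q2 q3 : is_line l -> l q1 -> l q2 -> l q3 ->
  (q3.1 - q1.1) * (q2.2 - q1.2) = (q3.2 - q1.2) * (q2.1 - q1.1).
Proof.
move=> ll l1 l2; have [al [be [ab0 e2 lP]]] := line_direction ll l1 l2.
move=> /lP e3; apply/eqP; rewrite -subr_eq0; apply/eqP.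
set D := _ - _; have : al * D = 0 /\ be * D = 0.
  split.
    transitivity ((q2.2 - q1.2) * 0 - (q3.2 - q1.2) * 0 : F); last by rewrite !mulr0 subrr.
    by rewrite -{1}e3 -e2 /D; ring.
  transitivity ((q3.1 - q1.1) * 0 - (q2.1 - q1.1) * 0 : F); last by rewrite !mulr0 subrr.
  by rewrite -{1}e2 -e3 /D; ring.
case=> /eqP; rewrite mulf_eq0 => /orP[/eqP al0|/eqP//] /eqP.
rewrite mulf_eq0 => /orP[/eqP be0|/eqP//].
by rewrite al0 be0 eqxx in ab0.
Qed.

Lemma line_unique l l' q1 q2 : is_line l -> is_line l' -> q1 != q2 ->
  l q1 -> l q2 -> l' q1 -> l' q2 -> l = l'.
Proof.
suff sub l1 l2 : is_line l1 -> is_line l2 -> q1 != q2 -> l1 q1 -> l1 q2 -> l2 q1 -> l2 q2 ->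
    (l1 `<=` l2)%classic.
  by move=> *; apply/seteqP; split; apply: sub.
move=> li1 li2 nq a1 a2 b1 b2 q a3.
have e := line_det li1 a1 a2 a3.
have [al [be [_ e2 lP]]] := line_direction li2 b1 b2; apply/lP.
set D := _ + _; have : (q2.1 - q1.1) * D = 0 /\ (q2.2 - q1.2) * D = 0.
  split.
    transitivity ((q.1 - q1.1) * (al * (q2.1 - q1.1) + be * (q2.2 - q1.2))
      + be * ((q.2 - q1.2) * (q2.1 - q1.1) - (q.1 - q1.1) * (q2.2 - q1.2))).
      by rewrite /D; ring.
    by rewrite e2 e subrr !mulr0 addr0.
  transitivity ((q.2 - q1.2) * (al * (q2.1 - q1.1) + be * (q2.2 - q1.2))
    + al * ((q.1 - q1.1) * (q2.2 - q1.2) - (q.2 - q1.2) * (q2.1 - q1.1))).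
    by rewrite /D; ring.
  by rewrite e2 e subrr !mulr0 addr0.
case=> /eqP; rewrite mulf_eq0 subr_eq0 => /orP[/eqP h1|/eqP//] /eqP.
rewrite mulf_eq0 subr_eq0 => /orP[/eqP h2|/eqP//].
by case/eqP: nq; case: (q1) (q2) h1 h2 => [? ?] [? ?] /= -> ->.
Qed.
End Lines.

(** * Incidences between a grid and a set of lines *)

Section Grid.
Variables (F : fieldType) (S T : finType) (a : S -> F) (b : T -> F).
Hypotheses (a_inj : injective a) (b_inj : injective b).
Local Open Scope nat_scope.

(** A triple that is not generic has all its points on a vertical line, or all on a horizontal one,
    or has its first two points equal; in the last case exchanging the last two points makes it
    generic unless one of the former cases holds. *)
Lemma card_on_line :
  #|[set z | on_line a b z.1 z.2]|
    <= 2 * #|generic_triples a b| + #|S| * #|T| ^ 3 + #|S| ^ 3 * #|T|.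
Proof.
pose sw (z : (S * S * S) * (T * T * T)) :=
  ((z.1.1.1, z.1.2, z.1.1.2), (z.2.1.1, z.2.2, z.2.1.2)).
pose V := [set ((z.1, z.1, z.1), z.2) | z in [set: S * (T * T * T)]].
pose H := [set (z.1, (z.2, z.2, z.2)) | z in [set: (S * S * S) * T]].
have sub : [set z | on_line a b z.1 z.2] \subset
    generic_triples a b :|: sw @: generic_triples a b :|: V :|: H.
  apply/fintype.subsetP => z; rewrite inE => ol; rewrite !finset.in_setU.
  case: z ol => [[[x1 x2] x3] [[y1 y2] y3]] ol.
  have Vx : x1 = x2 -> x1 = x3 -> ((x1, x2, x3), (y1, y2, y3)) \in V.
    by move=> <- <-; apply/imsetP; exists (x1, (y1, y2, y3)).
  have Hy : y1 = y2 -> y1 = y3 -> ((x1, x2, x3), (y1, y2, y3)) \in H.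
    by move=> <- <-; apply/imsetP; exists ((x1, x2, x3), y1).
  have := ol; rewrite /on_line /= => ol'.
  have [ex|nx] := eqVneq x1 x2; have [ey|ny] := eqVneq y1 y2.
  - have [ex3|nx3] := eqVneq x1 x3; first by rewrite Vx ?orbT.
    have [ey3|ny3] := eqVneq y1 y3; first by rewrite Hy ?orbT.
    suff -> : ((x1, x2, x3), (y1, y2, y3)) \in sw @: generic_triples a b by rewrite !orbT.
    apply/imsetP; exists ((x1, x3, x2), (y1, y3, y2)) => //.
    by rewrite inE nx3 ny3 /on_line /= -ex -ey !subrr !mul0r.
  - rewrite Vx ?orbT //; apply/eqP; rewrite eq_sym -(inj_eq a_inj) -subr_eq0.
    move: ol'; rewrite -ex subrr mulr0 mulf_eq0 => /orP[//|].
    by move=> h; case/eqP: ny; apply/b_inj/esym/eqP; rewrite -subr_eq0.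
  - rewrite Hy ?orbT //; apply/eqP; rewrite eq_sym -(inj_eq b_inj) -subr_eq0.
    move: ol'; rewrite -ey subrr mulr0 eq_sym mulf_eq0 => /orP[//|].
    by move=> h; case/eqP: nx; apply/a_inj/esym/eqP; rewrite -subr_eq0.
  - by rewrite inE nx ny ol.
apply: leq_trans (subset_leq_card sub) _.
have cU (A B : {set (S * S * S) * (T * T * T)}) m n :
    #|A| <= m -> #|B| <= n -> #|A :|: B| <= m + n.
  by move=> hA hB; apply: leq_trans (leq_card_setU A B).1 (leq_add hA hB).
have hV : #|V| <= #|S| * #|T| ^ 3.
  by apply: leq_trans (leq_imset_card _ _) _; rewrite cardsT !card_prod; lia.
have hH : #|H| <= #|S| ^ 3 * #|T|.
  by apply: leq_trans (leq_imset_card _ _) _; rewrite cardsT !card_prod; lia.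
rewrite mul2n -addnn.
exact: cU (cU _ _ _ _ (cU _ _ _ _ (leqnn _) (leq_imset_card _ _)) hV) hH.
Qed.

Variables (L : finType) (line : L -> set (F * F)).
Hypotheses (line_inj : injective line) (lineP : forall l, is_line (line l)).

Let pt (q : S * T) : F * F := (a q.1, b q.2).

Definition on_grid (q : S * T) l := `[< line l (pt q) >].
Definition line_points l := [set q | on_grid q l].

Let pt_inj : injective pt.
Proof. by move=> [x y] [x' y'] [/a_inj-> /b_inj->]. Qed.

(** Only lines holding two distinct grid points on a vertical count, so a line with at most one grid
    point is oblique whatever its slope. *)
Let vertical l := [exists q, exists q',
  [&& on_grid q l, on_grid q' l, q.1 == q'.1 & q.2 != q'.2]].
Let horizontal l := [exists q, exists q',
  [&& on_grid q l, on_grid q' l, q.2 == q'.2 & q.1 != q'.1]].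

Definition oblique l := ~~ vertical l && ~~ horizontal l.

Let verticalE l q : vertical l -> on_grid q l -> line l = [set z | z.1 = a q.1]%classic.
Proof.
move=> /existsP[q1 /existsP[q2 /and4P[/asboolP l1 /asboolP l2 /eqP e n]]] /asboolP lq.
have vl x : is_line [set z : F * F | z.1 = x]%classic.
  exists 1%R, 0%R, x; split; first by rewrite xpair_eqE oner_eq0.
  by apply/seteqP; split => z /=; rewrite mul1r mul0r addr0.
have E : line l = [set z | z.1 = a q1.1]%classic.
  apply: (@line_unique _ _ _ (pt q1) (pt q2)) => //=; last by rewrite e.
  by apply: contra_neq n => /pt_inj ->.
by move: lq; rewrite E /= => ->.
Qed.

Let horizontalE l q : horizontal l -> on_grid q l -> line l = [set z | z.2 = b q.2]%classic.
Proof.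
move=> /existsP[q1 /existsP[q2 /and4P[/asboolP l1 /asboolP l2 /eqP e n]]] /asboolP lq.
have vl x : is_line [set z : F * F | z.2 = x]%classic.
  exists 0%R, 1%R, x; split; first by rewrite xpair_eqE oner_eq0 andbF.
  by apply/seteqP; split => z /=; rewrite mul1r mul0r add0r.
have E : line l = [set z | z.2 = b q1.2]%classic.
  apply: (@line_unique _ _ _ (pt q1) (pt q2)) => //=; last by rewrite e.
  by apply: contra_neq n => /pt_inj ->.
by move: lq; rewrite E /= => ->.
Qed.

Let card_incidence_sum (P : pred L) :
  #|[set z : (S * T) * L | on_grid z.1 z.2 && P z.2]| = \sum_(l | P l) #|line_points l|.
Proof.
rewrite -sum1_card (eq_bigl (fun z : (S * T) * L => on_grid z.1 z.2 && P z.2)); last first.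
  by move=> z; rewrite inE.
rewrite (eq_bigr (fun l => \sum_(q | on_grid q l) 1)); last first.
  by move=> l _; rewrite sum1_card -[RHS]cardsE.
rewrite (exchange_big_dep predT) //= pair_big_dep /=.
by apply: eq_bigl => -[q l] /=; rewrite andbC.
Qed.

(** A grid point lies on at most one vertical and one horizontal line, which accounts for twice the
    size of the grid. *)
Lemma card_incidences :
  #|[set z : (S * T) * L | on_grid z.1 z.2]|
    <= 2 * (#|S| * #|T|) + \sum_(l | oblique l) #|line_points l|.
Proof.
rewrite -card_incidence_sum.
have inj1 (P : pred L) : (forall q l l', P l -> P l' -> on_grid q l -> on_grid q l' -> l = l') ->
    #|[set z : (S * T) * L | on_grid z.1 z.2 && P z.2]| <= #|S| * #|T|.
  move=> PI; rewrite -card_prod -(@card_in_imset _ _ fst) ?max_card // => -[q l] [q' l'].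
  rewrite !inE /= => /andP[ql Pl] /andP[q'l' Pl'] e; rewrite e in ql *.
  by rewrite (PI _ _ _ Pl Pl' ql q'l').
have cV : #|[set z : (S * T) * L | on_grid z.1 z.2 && vertical z.2]| <= #|S| * #|T|.
  apply: inj1 => q l l' v v' ql ql'; apply: line_inj.
  by rewrite (verticalE v ql) (verticalE v' ql').
have cH : #|[set z : (S * T) * L | on_grid z.1 z.2 && horizontal z.2]| <= #|S| * #|T|.
  apply: inj1 => q l l' v v' ql ql'; apply: line_inj.
  by rewrite (horizontalE v ql) (horizontalE v' ql').
rewrite mul2n -addnn; apply: leq_trans (leq_add (leq_add cV cH) (leqnn _)).
apply: leq_trans (leq_add (leq_card_setU _ _).1 (leqnn _)).
apply: leq_trans (leq_card_setU _ _).1; apply: subset_leq_card.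
apply/fintype.subsetP => z; rewrite !finset.in_setU !finset.in_set /= /oblique => ->.
by case: (vertical _); case: (horizontal _).
Qed.

Let in_fin := (finset.in_set, finset.in_setI, finset.in_setD, finset.in_setX).

(** A line with k points carries k^2 (k - 1) triples whose first two points are distinct. On an
    oblique line such points differ in both coordinates, so the triple is generic. *)
Lemma card_oblique_triples :
  \sum_(l | oblique l) (#|line_points l| ^ 2 * (#|line_points l| - 1))
    <= #|generic_triples a b|.
Proof.
pose phi (t : (S * T) * (S * T) * (S * T)) :=
  ((t.1.1.1, t.1.2.1, t.2.1), (t.1.1.2, t.1.2.2, t.2.2)).
have phi_inj : injective phi by move=> [[[? ?] [? ?]] [? ?]] [[[? ?] [? ?]] [? ?]] [-> -> -> -> -> ->].
pose pairs l := finset.setX (line_points l) (line_points l) :\: [set q | q.1 == q.2].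
pose W l := phi @: finset.setX (pairs l) (line_points l).
have cardW l : #|W l| = #|line_points l| ^ 2 * (#|line_points l| - 1).
  rewrite card_imset // finset.cardsX.
  have : #|finset.setX (line_points l) (line_points l) :&: [set q | q.1 == q.2]| = #|line_points l|.
    rewrite -(@card_imset _ _ (fun q : S * T => (q, q)) (line_points l)); last by move=> ? ? [].
    apply: eq_card => -[q q']; rewrite !in_fin /=; apply/idP/imsetP.
      by move=> /andP[/andP[lq _] /eqP<-]; exists q; rewrite ?in_fin.
    by case=> q0; rewrite in_fin => lq [-> ->]; rewrite lq eqxx.
  have := cardsID [set q | q.1 == q.2] (finset.setX (line_points l) (line_points l)).
  rewrite -/(pairs l) finset.cardsX => h1 h2; rewrite h2 in h1.
  have -> : #|pairs l| = #|line_points l| * #|line_points l| - #|line_points l|.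
    by rewrite -h1 addKn.
  by rewrite expnS expn1 mulnBr muln1 mulnBl.
have WP l z : z \in W l -> oblique l ->
    [/\ z \in generic_triples a b & exists q1 q2, [/\ z.1.1 = (q1.1, q2.1), z.2.1 = (q1.2, q2.2),
       q1 != q2, on_grid q1 l & on_grid q2 l]].
  case/imsetP=> [[[q1 q2] q3]]; rewrite !in_fin /= => /andP[/andP[n12 /andP[l1 l2]] l3] -> ob.
  move: ob; rewrite /oblique !negb_exists => /andP[/forallP/(_ q1)] .
  rewrite !negb_exists => /forallP/(_ q2); rewrite l1 l2 /= => v /forallP/(_ q1).
  rewrite !negb_exists => /forallP/(_ q2); rewrite l1 l2 /= => h.
  split; last by exists q1, q2.
  have n : (q1.1 != q2.1) && (q1.2 != q2.2).
    move: v h n12; case: (q1) (q2) => [x y] [x' y'] /=; rewrite xpair_eqE.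
    by case: (x == x'); case: (y == y').
  case/andP: n => -> -> /=; apply/eqP.
  exact: (line_det (lineP l) (asboolW l1) (asboolW l2) (asboolW l3)).
rewrite (eq_bigr (fun l => #|W l|)) => [|l _]; last by rewrite cardW.
rewrite (eq_bigr (fun l => \sum_(z in generic_triples a b | z \in W l) 1)); last first.
  move=> l ob; rewrite sum1_card; apply: eq_card => z; rewrite [RHS]unfold_in /=.
  by apply/idP/andP => [zW|[]//]; have [zG _] := WP l z zW ob.
rewrite (exchange_big_dep (fun z => z \in generic_triples a b)) /=; last by move=> l z _ /andP[].
rewrite -[leqRHS]sum1_card; apply: leq_sum => z zG.
(* The first two points of the triple are distinct and determine the line. *)
rewrite sum1_card; apply/card_le1_eqP => l l' /and3P[ob _ zl] /and3P[ob' _ zl'].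
have [_ [q1 [q2 [e1 e2 n12 l1 l2]]]] := WP _ _ zl ob.
have [_ [r1 [r2 [f1 f2 _ r1l r2l]]]] := WP _ _ zl' ob'.
have [er1 er2] : q1 = r1 /\ q2 = r2.
  rewrite f1 in e1; rewrite f2 in e2; case: e1 => e11 e12; case: e2 => e21 e22.
  by rewrite [q1]surjective_pairing [q2]surjective_pairing -e11 -e12 -e21 -e22 -!surjective_pairing.
have npt : pt q1 != pt q2 by apply: contra_neq n12 => /pt_inj.
rewrite -er1 in r1l; rewrite -er2 in r2l.
have e := line_unique (lineP l) (lineP l') npt (asboolW l1) (asboolW l2) (asboolW r1l) (asboolW r2l).
exact: line_inj (esym e).
Qed.
End Grid.

Local Open Scope fset_scope.
Local Open Scope ring_scope.

Section FsetGrid.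
Variables (F : fieldType) (A B : {fset F}).
Let a (x : A) : F := val x.
Let b (y : B) : F := val y.

Lemma card_fset_le (X : choiceType) (Y : finType) (D : {set Y}) (E : {fset X}) (g : Y -> X) :
  (forall x, x \in E -> exists2 y, y \in D & x = g y) -> (#|` E| <= #|D|)%N.
Proof.
move=> EP; rewrite cardE -(size_map g); apply: uniq_leq_size => [|x /EP[y yD ->]].
  exact: fset_uniq.
by apply: map_f; rewrite mem_enum.
Qed.

Lemma card_fset_prod : #|` A `*` B| = (#|` A| * #|` B|)%N.
Proof.
pose g (z : A * B) : F * F := (a z.1, b z.2).
have gI : injective g by move=> [x y] [x' y'] [/val_inj -> /val_inj ->].
rewrite !cardfE -card_prod; apply/eqP; rewrite eqn_leq; apply/andP; split.
  rewrite -cardfE -(cardsT (A * B)%type).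
  apply: (@card_fset_le _ _ _ _ g) => -[x y].
  rewrite in_fsetM => /andP[/= xA yB]; exists ([` xA], [` yB]) => //.
  exact: finset.in_setT.
rewrite -cardfE cardE -(size_map g); apply: uniq_leq_size => [|z /mapP[q _ ->]].
  by rewrite map_inj_uniq ?enum_uniq.
by rewrite in_fsetM; apply/andP; split; apply: fsvalP.
Qed.

Lemma card_collinear_triples :
  (#|` collinear_triples (A `*` B)| <= #|[set z | on_line a b z.1 z.2]|)%N.
Proof.
pose g (z : (A * A * A) * (B * B * B)) :=
  ((a z.1.1.1, b z.2.1.1), (a z.1.1.2, b z.2.1.2), (a z.1.2, b z.2.2)).
apply: (@card_fset_le _ _ _ _ g) => -[[[x1 y1] [x2 y2]] [x3 y3]].
rewrite !inE /= => /andP[/andP[/andP[/andP[A1 B1] /andP[A2 B2]] /andP[A3 B3]]].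
move=> /asboolP[l [ll l1 l2 l3]].
exists (([` A1], [` A2], [` A3]), ([` B1], [` B2], [` B3])) => //.
by rewrite finset.in_set /on_line /a /b /=; apply/eqP; apply: (line_det ll l1 l2 l3).
Qed.

Lemma card_fset_incidences (M : {fset set (F * F)}) :
  (#|` incidences (A `*` B) M|
     <= #|[set z : (A * B) * M | on_grid a b (fun l : M => val l) z.1 z.2]|)%N.
Proof.
pose g (z : (A * B) * M) : F * F * set (F * F) := ((a z.1.1, b z.1.2), val z.2).
apply: (@card_fset_le _ _ _ _ g) => -[[x y] l].
rewrite !inE /= => /andP[/andP[/andP[xA yB] lM] on].
by exists (([` xA], [` yB]), [` lM]); rewrite ?finset.in_set.
Qed.
End FsetGrid.

(** * Passage to real exponents *)

Section RealBounds.
Variable R : realType.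

Lemma cube_lt_square (N p : nat) :
  N%:R < p%:R `^ (2 / 3) :> R -> (N ^ 3 < p ^ 2)%N.
Proof.
move=> lt_N; rewrite -(ltr_nat R) !natrX.
have -> : (p%:R : R) ^+ 2 = (p%:R `^ (2 / 3)) ^+ 3.
  rewrite -[RHS]powR_mulrn ?powR_ge0 // -powRrM divfK ?pnatr_eq0 //.
  by rewrite powR_mulrn.
by rewrite ltr_pXn2r // ?nnegrE ?powR_ge0.
Qed.

Lemma powR_quarter (n k : nat) : (n%:R `^ (k%:R / 4) : R) ^+ 4 = n%:R ^+ k.
Proof.
by rewrite -powR_mulrn ?powR_ge0 // -powRrM divfK ?pnatr_eq0 // powR_mulrn.
Qed.

Lemma powR_three_quarters (n : nat) :
  n%:R `^ (9 / 4) = (n%:R `^ (3 / 4) : R) ^+ 3.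
Proof. by rewrite -powR_mulrn ?powR_ge0 // -powRrM; congr (_ `^ _); field. Qed.

Lemma fourth_power_bound (G n : nat) : (G ^ 4 <= 57 ^ 4 * n ^ 9)%N ->
  G%:R <= 57 * (n%:R `^ (9 / 4)) :> R.
Proof.
move=> le_G; rewrite -(@ler_pXn2r _ 4) // ?nnegrE ?mulr_ge0 ?powR_ge0 //.
rewrite exprMn powR_quarter.
by move: le_G; rewrite -(ler_nat R) natrM !natrX.
Qed.

(* Termwise, [k <= 1 + t + 2 k^2 (k - 1) / t^2] with [t = w / u]. *)
Lemma sum_le_of_cubic (L : finType) (P : pred L) (k : L -> nat) (G : nat) (w u : R) :
  0 < w -> 0 < u -> #|L|%:R = u ^+ 3 -> G%:R <= 57 * w ^+ 3 ->
  (\sum_(l | P l) (k l ^ 2 * (k l - 1)) <= G)%N ->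
  (\sum_(l | P l) k l)%N%:R <= u ^+ 3 + 115 * (w * u ^+ 2).
Proof.
move=> w0 u0 cL GE le_G; pose t := w / u; have t0 : 0 < t by rewrite divr_gt0.
have one l : (k l)%:R <= 1 + t + 2 / t ^+ 2 * (k l ^ 2 * (k l - 1))%:R.
  have c0 : 0 <= 2 / t ^+ 2 by rewrite divr_ge0 ?exprn_ge0 // ltW.
  have c1 z : 0 <= 2 / t ^+ 2 * z%:R by rewrite mulr_ge0.
  case: (k l) => [|[|n]].
  - by rewrite addr_ge0 ?c1 ?addr_ge0 ?ltW.
  - by rewrite -addrA lerDl addr_ge0 ?c1 ?ltW.
  set x : R := n.+2%:R.
  have x2 : 2 <= x by rewrite /x ler_nat.
  have -> : (n.+2 ^ 2 * (n.+2 - 1))%:R = x ^+ 2 * (x - 1).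
    by rewrite natrM natrX natrB.
  have y0 : 0 <= x ^+ 2 * (x - 1) by rewrite mulr_ge0 ?sqr_ge0 //; lra.
  have cy0 : 0 <= 2 / t ^+ 2 * (x ^+ 2 * (x - 1)) by rewrite mulr_ge0.
  have [xt|xt] := lerP x t; first by lra.
  (* For t < x and 2 <= x: x t^2 <= x^3 <= 2 x^2 (x - 1). *)
  suff : x <= 2 / t ^+ 2 * (x ^+ 2 * (x - 1)) by lra.
  rewrite mulrAC ler_pdivlMr ?exprn_gt0 //.
  have tx : t ^+ 2 <= x ^+ 2 by rewrite ler_pXn2r ?nnegrE ?ltW // (lt_trans t0).
  have x0 : 0 <= x by lra.
  have h : x * t ^+ 2 <= x * x ^+ 2 by rewrite ler_wpM2l.
  apply: le_trans h _; rewrite [leRHS](_ : _ = (2 * (x - 1)) * x ^+ 2); last by ring.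
  by rewrite ler_wpM2r ?sqr_ge0 //; lra.
rewrite natr_sum; apply: le_trans (ler_sum _ (fun l _ => one l)) _.
rewrite big_split /= -mulr_sumr -natr_sum.
have wu : 0 <= w * u ^+ 2 by rewrite mulr_ge0 ?sqr_ge0 // ltW.
have h1 : \sum_(l | P l) (1 + t) <= u ^+ 3 + w * u ^+ 2.
  rewrite sumr_const -mulr_natl.
  have -> : u ^+ 3 + w * u ^+ 2 = u ^+ 3 * (1 + t) by rewrite /t; field; rewrite gt_eqF.
  apply: ler_wpM2r; first by rewrite addr_ge0 // ltW.
  by rewrite -cL ler_nat max_card.
have h2 : 2 / t ^+ 2 * (\sum_(l | P l) k l ^ 2 * (k l - 1))%N%:R <= 114 * (w * u ^+ 2).
  have -> : 114 * (w * u ^+ 2) = 2 / t ^+ 2 * (57 * w ^+ 3).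
    by rewrite /t; field; rewrite !gt_eqF.
  apply: ler_wpM2l; first by rewrite divr_ge0 ?exprn_ge0 // ltW.
  by apply: le_trans GE; rewrite ler_nat.
lra.
Qed.
End RealBounds.

Theorem corollary8 (R : realType) :
  exists C : R, 0 < C /\
  forall (F : fieldType) (p : nat) (A B : {fset F}),
    p \in [pchar F] -> odd p ->
    0 \notin A -> 0 \notin B ->
    (1 < #|` A|)%N -> (1 < #|` B|)%N ->
    (#|` B| <= #|` A|)%N ->
    (#|` A|)%:R < p%:R `^ (2 / 3) :> R ->
    let P := A `*` B in
    let n := #|` P| in
    (#|` collinear_triples P|)%:R
      <= C * (n%:R `^ (9 / 4) + (#|` A|)%:R ^+ 3 * (#|` B|)%:R) /\
    forall (m : nat) (M : {fset set (F * F)}),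
      (1 <= m)%N -> #|` M| = m -> (forall l, l \in M -> is_line l) ->
      (#|` incidences P M|)%:R
        <= C * (n%:R `^ (3 / 4) * m%:R `^ (2 / 3) + m%:R + n%:R).
Proof.
(* 115 = 2 * 57 + 1: twice the constant for generic triples, and one more for the sum of the terms t
   = w / u over the lines. *)
exists 115; split=> // F p A B pF _ _ _ A1 B1 leBA ltA P n.
pose a (x : A) : F := val x; pose b (y : B) : F := val y.
have aI : injective a := val_inj; have bI : injective b := val_inj.
have cA : #|{: A}| = #|` A| by rewrite -cardfE.
have cB : #|{: B}| = #|` B| by rewrite -cardfE.
have nE : n = (#|` A| * #|` B|)%N by apply: card_fset_prod.
have pA := cube_lt_square ltA.
have pB : (#|` B| ^ 3 < p ^ 2)%N by apply: leq_ltn_trans pA; rewrite leq_exp2r.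
have le_G : #|generic_triples a b|%:R <= 57 * (n%:R `^ (9 / 4)) :> R.
  apply: fourth_power_bound; rewrite nE -cA -cB.
  by apply: (generic_triples_bound pF) => //; rewrite ?cA ?cB // ltnW.
have n0 : (0 < n)%N by rewrite nE muln_gt0 (ltnW A1) (ltnW B1).
split.
  have hT : (#|` collinear_triples P| <= 2 * #|generic_triples a b|
      + #|` A| * #|` B| ^ 3 + #|` A| ^ 3 * #|` B|)%N.
    by apply: leq_trans (card_collinear_triples A B) _; rewrite -cA -cB; apply: card_on_line.
  (* Since [B] is the smaller set, the bound for vertical triples is absorbed by that for horizontal
     ones. *)
  have hB : (#|` A| * #|` B| ^ 3 <= #|` A| ^ 3 * #|` B|)%N.
    rewrite (expnS _ 2) mulnA (expnS _ 2) mulnAC [leqRHS]mulnAC.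
    by rewrite mulnAC leq_mul2l leq_exp2r // leBA orbT.
  have {hT}: (#|` collinear_triples P| <= 2 * #|generic_triples a b|
      + 2 * (#|` A| ^ 3 * #|` B|))%N.
    apply: leq_trans hT _.
    by rewrite -addnA leq_add2l [leqRHS]mul2n -addnn leq_add2r.
  rewrite -natrX -natrM; move: (#|` A| ^ 3 * #|` B|)%N => y.
  rewrite -(ler_nat R) natrD !natrM => /le_trans; apply.
  have y0 : 0 <= y%:R :> R by [].
  have n94 : 0 <= n%:R `^ (9 / 4) :> R by apply: powR_ge0.
  lra.
move=> m M m1 cM linesM.
have cL : #|{: M}| = m by rewrite -cM -cardfE.
have lineP (l : M) : is_line (val l) by apply: linesM; apply: fsvalP.
have hI := leq_trans (card_fset_incidences A B M) (card_incidences aI bI val_inj lineP).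
rewrite -/P cA cB -nE in hI.
(* In these variables n^(9/4) and m are cubes, and the main term is w u^2. *)
set w : R := n%:R `^ (3 / 4); pose u : R := m%:R `^ (3^-1).
have w0 : 0 < w by apply: powR_gt0; rewrite ltr0n.
have u0 : 0 < u by apply: powR_gt0; rewrite ltr0n.
have u3 : m%:R = u ^+ 3.
  by rewrite -powR_mulrn ?powR_ge0 // -powRrM mulVf ?pnatr_eq0 // powRr1.
have u2 : m%:R `^ (2 / 3) = u ^+ 2 by rewrite -powR_mulrn ?powR_ge0 // -powRrM mulrC.
have GE : #|generic_triples a b|%:R <= 57 * w ^+ 3 by rewrite -powR_three_quarters.
have hS := sum_le_of_cubic w0 u0 (etrans (congr1 _ cL) u3) GE
  (card_oblique_triples aI bI val_inj lineP).
rewrite u2 u3.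
move: hI; rewrite -(ler_nat R) natrD natrM => /le_trans; apply.
apply: le_trans (lerD (lexx _) hS) _.
have : 0 <= u ^+ 3 by rewrite exprn_ge0 // ltW.
have : 0 <= n%:R :> R by [].
lra.
Qed.
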